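(* Eventual strong detectability of finite automata can be verified in polynomial time: there is an algorithm that, given a finite automaton $\mathcal{S}$, decides in time polynomial in the size of $\mathcal{S}$ whether $\mathcal{S}$ is eventually strongly detectable.
   Context: A finite automaton is a sextuple $\mathcal{S}=(X,T,X_0,\to,\Sigma,\ell)$ with $X$ a finite set of states, $T$ a finite set of events, $X_0\subset X$ a set of initial states, $\to\subset X\times T\times X$ a transition relation, $\Sigma$ a finite set of outputs (labels), and $\ell:T\to\Sigma\cup\{\epsilon\}$ a labeling function ($\epsilon$ the empty word), extended to finite and infinite event sequences by concatenation. No deadlock-freeness or promptness assumption is made. Write $x\xrightarrow{s}x'$ for $s\in T^+$ if there is a sequence of transitions from $x$ to $x'$ with event sequence $s$. For $\sigma\in\Sigma^*$, $\mathcal{M}(\mathcal{S},\sigma)=\{x\in X\mid \exists x_0\in X_0,\exists s\in T^+: \ell(s)=\sigma,\ x_0\xrightarrow{s}x\}$, with $X_0$ additionally included when $\sigma=\epsilon$. An infinite event sequence $t_1t_2\dots\in T^\omega$ is generated by $\mathcal{S}$ if there are states $x_0,x_1,\dots$ with $x_0\in X_0$ and $(x_i,t_{i+1},x_{i+1})\in\to$ for all $i\in\mathbb{N}$; $\mathcal{L}^\omega(\mathcal{S})$ is the set of $\sigma\in\Sigma^\omega$ that equal $\ell(t_1t_2\dots)$ for some generated $t_1t_2\dots$. $\mathcal{S}$ is eventually strongly detectable if for every $\sigma\in\mathcal{L}^\omega(\mathcal{S})$ there is a positive integer $k_\sigma$ such that $|\mathcal{M}(\mathcal{S},\sigma')|=1$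 for every finite prefix $\sigma'$ of $\sigma$ with $|\sigma'|>k_\sigma$. *)

(* Defs.v *)
From HB Require Import structures.
From mathcomp Require Import all_boot all_order all_algebra.
From mathcomp Require Import boolp.
Set Implicit Arguments.
Unset Strict Implicit.
Unset Printing Implicit Defensive.

Record automaton := Automaton {
  state : finType;
  event : finType;
  output : finType;
  initial : {set state};
  transition : {set state * event * state};
  label : event -> option output (* None is the empty word *)
}.

Section Automata.
Variable S : automaton.
Implicit Types (x y : state S) (s : seq (event S)) (t : nat -> event S).

Definition labels s : seq (output S) := pmap (@label S) s.

Fixpoint steps x s y : Prop :=
  match s with
  | [::] => x = y
  | e :: s' => exists2 z, (x, e, z) \in transition S & steps z s' y
  end.

Definition current_states (sigma : seq (output S)) : {set state S} :=
  [set x | `[< exists x0 s, [/\ x0 \in initial S, s <> [::],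
                               labels s = sigma & steps x0 s x] >]]
  :|: (if sigma is [::] then initial S else set0).

Definition generated t : Prop :=
  exists x : nat -> state S,
    x 0 \in initial S /\ forall i, (x i, t i, x i.+1) \in transition S.

(* The infinite concatenation l(t_0) l(t_1) ... is the infinite word sigma; this
   fails when only finitely many of the t_i have a nonempty label. *)
Definition omega_labels t (sigma : nat -> output S) : Prop :=
  (forall m, let u := labels (mkseq t m) in u = mkseq sigma (size u)) /\
  (forall n, exists m, n <= size (labels (mkseq t m))).

Definition omega_language (sigma : nat -> output S) : Prop :=
  exists2 t, generated t & omega_labels t sigma.

Definition eventually_strongly_detectable : Prop :=
  forall sigma, omega_language sigma ->
    exists2 k, 0 < k &
      forall n, k < n -> #|current_states (mkseq sigma n)| = 1.

Definition automaton_size : nat :=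
  #|state S| + #|event S| + #|output S| + #|initial S| + #|transition S|.

(* States, events and outputs are numbered by enum_rank; the empty label is
   written 0 and the output of rank r is written r.+1. *)
Definition encode_label (o : option (output S)) : nat :=
  if o is Some a then (enum_rank a).+1 else 0.

Definition encode_transition (tr : state S * event S * state S) : seq nat :=
  [:: enum_rank tr.1.1 : nat; enum_rank tr.1.2 : nat; enum_rank tr.2 : nat].

Definition encode_automaton : seq nat :=
  [:: #|state S|; #|event S|; #|output S|; #|initial S|; #|transition S|]
  ++ [seq (enum_rank x : nat) | x <- enum (initial S)]
  ++ [seq encode_label (label e) | e <- enum (event S)]
  ++ flatten [seq encode_transition tr | tr <- enum (transition S)].

End Automata.

(* Random access machines in the style of Cook and Reckhow, with registers
   holding natural numbers, a read-only input tape, and logarithmic cost.  There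
   is no multiplication instruction.  Polynomial time on these machines is
   polynomial time on Turing machines. *)
Inductive instr :=
  | IConst of nat & nat         (* IConst i c : r_i := c *)
  | IAdd of nat & nat & nat     (* IAdd i j k : r_i := r_j + r_k *)
  | ISub of nat & nat & nat     (* ISub i j k : r_i := r_j - r_k, truncated *)
  | ILoad of nat & nat          (* ILoad i j  : r_i := r_(r_j) *)
  | IStore of nat & nat         (* IStore i j : r_(r_i) := r_j *)
  | IRead of nat                (* IRead i    : r_i := next input, 0 if none *)
  | IJpos of nat & nat          (* IJpos j l  : if r_j > 0, go to instruction l *)
  | IHalt of bool.              (* halt, accepting or rejecting *)

Definition program := seq instr.

Record config := Config { pc : nat; reg : nat -> nat; tape : seq nat }.

Definition start (w : seq nat) : config := Config 0 (fun=> 0) w.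

Definition upd (m : nat -> nat) (i v : nat) : nat -> nat :=
  fun j => if j == i then v else m j.

Definition exec_instr (I : instr) (c : config) : option config :=
  let: Config p m w := c in
  match I with
  | IConst i a => Some (Config p.+1 (upd m i a) w)
  | IAdd i j k => Some (Config p.+1 (upd m i (m j + m k)) w)
  | ISub i j k => Some (Config p.+1 (upd m i (m j - m k)) w)
  | ILoad i j => Some (Config p.+1 (upd m i (m (m j))) w)
  | IStore i j => Some (Config p.+1 (upd m (m i) (m j)) w)
  | IRead i => Some (Config p.+1 (upd m i (head 0 w)) (behead w))
  | IJpos j l => Some (Config (if 0 < m j then l else p.+1) m w)
  | IHalt _ => None
  end.

(* The number of binary digits of n, with value 1 at n = 0. *)
Definition bitlen (n : nat) : nat := (trunc_log 2 n).+1.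

Definition cost (I : instr) (c : config) : nat :=
  let: Config p m w := c in
  match I with
  | IConst _ a => bitlen a
  | IAdd _ j k | ISub _ j k => bitlen (m j) + bitlen (m k)
  | ILoad _ j => bitlen (m j) + bitlen (m (m j))
  | IStore i j => bitlen (m i) + bitlen (m j)
  | IRead _ => bitlen (head 0 w)
  | IJpos j _ => bitlen (m j)
  | IHalt _ => 1
  end.

(* halts_with P c b n: from c, P reaches IHalt b at total cost n.  Running off
   the program is not halting. *)
Inductive halts_with (P : program) : config -> bool -> nat -> Prop :=
  | halts_now c b :
      onth P (pc c) = Some (IHalt b) -> halts_with P c b (cost (IHalt b) c)
  | halts_later c c' I b n :
      onth P (pc c) = Some I -> exec_instr I c = Some c' ->
      halts_with P c' b n -> halts_with P c b (cost I c + n).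

Definition poly_time_decidable (A : Type) (encode : A -> seq nat)
    (size : A -> nat) (L : A -> Prop) : Prop :=
  exists (P : program) (p : {poly nat}), forall a : A, exists (b : bool) (n : nat),
    [/\ halts_with P (start (encode a)) b n, n <= p.[size a]%R & b <-> L a].

(* Main.v *)
From mathcomp Require Import all_boot all_algebra.
From mathcomp Require Import boolp zify.
Require Import Defs.
Set Implicit Arguments.
Unset Strict Implicit.
Unset Printing Implicit Defensive.

(* Pairs of states with a flag form a graph of polynomial size, with two kinds of
   edges: both components move with the same label (a component may also rest,
   as if by an unobservable event), the flag recording nonempty labels; or the
   second component is replaced by the first one.  Along a path of this graph
   both components stay possible current states after the same observation, and
   the first one follows a genuine run.  A cycle with nonempty label through a
   reachable pair (q, r) with q <> r therefore yields an infinite observation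
   which is infinitely often ambiguous.  Conversely, let such an observation be
   produced by a run x, let q be a state that x visits infinitely often, and
   let an ambiguous position come after more than |X| such visits.  The run
   leading to the second possible state either meets q at one of these visits,
   and then one resets after the ambiguity and follows x back to q; or, by the
   pigeonhole principle, it is twice in the same state r <> q while x is in q.

   The existence of such a cycle is decided by a program in a small language of
   nested bounded loops, which is compiled to the random access machine.  Its
   number of steps is bounded by a polynomial in the loop bounds, and since one
   step at most doubles the largest number in store, its logarithmic cost is
   polynomial as well. *)

(** * Ambiguous observations and cycles of pairs *)

Section Criterion.
Variable S : automaton.
Implicit Types (x y z : state S) (s : seq (event S)) (sg : seq (output S)).

(** * Event sequences, their labels, and the states possible after an observation *)

Lemma labels_cat s1 s2 : labels (s1 ++ s2) = labels s1 ++ labels s2.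
Proof. exact: pmap_cat. Qed.

Lemma steps_cat x s1 s2 z :
  steps x (s1 ++ s2) z <-> exists2 y, steps x s1 y & steps y s2 z.
Proof.
elim: s1 x => [|e s1 IH] x /=.
  by split=> [?|[y -> //]]; exists x.
split=> [[u xu /IH[y uy yz]]|[y [u xu uy] yz]].
  by exists y => //; exists u.
by exists u => //; apply/IH; exists y.
Qed.

(** Allowing the empty event sequence absorbs the separate clause for the empty word in
    [current_states]. *)
Definition occurs sg x : Prop :=
  exists x0 s, [/\ x0 \in initial S, labels s = sg & steps x0 s x].

Lemma current_statesP sg x : x \in current_states sg <-> occurs sg x.
Proof.
rewrite /current_states in_setU inE; split.
  case/orP => [/asboolP[x0 [s [? _ ? ?]]]|]; first by exists x0, s.
  by case: sg => [|? ?]; rewrite ?inE // => ix; exists x, [::].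
case=> x0 [[|e s] [ix lab st]]; last by apply/orP; left; apply/asboolP; exists x0, (e :: s).
by rewrite -lab /= -(st : x0 = x) ix orbT.
Qed.

(* A pair (x, None, x) lets one component of a pair rest while the other one
   performs an unobservable event. *)
Definition moves : seq (state S * option (output S) * state S) :=
  [seq (tr.1.1, label tr.1.2, tr.2) | tr <- enum (transition S)]
  ++ [seq (x, None, x) | x <- enum (state S)].

Lemma movesP x o y :
  reflect ((exists2 e, (x, e, y) \in transition S & label e = o)
           \/ (o = None /\ x = y))
          ((x, o, y) \in moves).
Proof.
rewrite mem_cat; apply: (iffP orP) => [[|]|[[e tr <-]|[-> ->]]].
- by case/mapP => -[[x' e] y']; rewrite mem_enum => tr /= [-> -> ->]; left; exists e.
- by case/mapP => z _ [-> -> ->]; right.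
- by left; apply/mapP; exists (x, e, y); rewrite ?mem_enum.
- by right; apply/mapP; exists y; rewrite ?mem_enum.
Qed.

Local Notation node := (state S * state S * bool)%type.

(* The second edge forgets the second component: a run that has died is
   replaced by a copy of the first one. *)
Definition pair_edge (u v : node) : bool :=
  [exists o, [&& (u.1.1, o, v.1.1) \in moves, (u.1.2, o, v.1.2) \in moves
             & v.2 == (u.2 || isSome o)]]
  || (v == (u.1.1, u.1.1, u.2)).

(** Edges never lower the flag. Starting at [true], the first path expresses plain reachability;
    rising from [false] to [true], the second is a cycle through the pair [(q, r)] with nonempty
    label. *)
Definition undetectable : Prop :=
  exists x0 y0 q r,
    [/\ x0 \in initial S, y0 \in initial S, q != r,
        connect pair_edge (x0, y0, true) (q, r, true)
      & connect pair_edge (q, r, false) (q, r, true)].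

Lemma connect_moves x y f o x' y' : (x, o, x') \in moves -> (y, o, y') \in moves ->
  connect pair_edge (x, y, f) (x', y', f || isSome o).
Proof.
move=> mx my; apply: connect1; apply/orP; left; apply/existsP; exists o.
by rewrite mx my /=.
Qed.

Lemma connect_reset x y f : connect pair_edge (x, y, f) (x, x, f).
Proof. by apply: connect1; rewrite /pair_edge /= eqxx orbT. Qed.

(** Unobservable events are played one at a time while the other component rests; once both
    sequences begin with an output, the outputs agree and both components move together. *)
Lemma connect_steps x s x' y s' y' f : steps x s x' -> steps y s' y' ->
  labels s = labels s' ->
  connect pair_edge (x, y, f) (x', y', f || (labels s != [::])).
Proof.
elim: s x y s' f => [|e s IH] x y s' f /=.
  move=> <-{x'}; elim: s' y => [|e s' IH] y /= => [<- _|].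
    by rewrite orbF connect0.
  case=> z tr st; case le: (label e) => [a|] //= lab.
  have my : (y, None, z) \in moves by apply/movesP; left; exists e.
  have mx : (x, None, x) \in moves by apply/movesP; right.
  have := connect_moves f mx my; rewrite /= !orbF => /connect_trans; apply.
  by have := IH z st lab; rewrite orbF.
case=> z tr st; case le: (label e) => [a|] /=; last first.
  move=> st' lab.
  have mx : (x, None, z) \in moves by apply/movesP; left; exists e.
  have my : (y, None, y) \in moves by apply/movesP; right.
  have := connect_moves f mx my; rewrite /= !orbF => /connect_trans; apply.
  exact: IH st st' lab.
elim: s' y => [|e' s' IHs] y //= [w tr' st']; case le': (label e') => [b|] /=.
  case=> ab lab.
  have mx : (x, Some a, z) \in moves by apply/movesP; left; exists e.
  have my : (y, Some a, w) \in moves by apply/movesP; left; exists e'; rewrite // ab.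
  have := connect_moves f mx my; rewrite /= !orbT => /connect_trans; apply.
  by have := IH z w s' true st st' lab.
move=> lab.
have mx : (x, None, x) \in moves by apply/movesP; right.
have my : (y, None, w) \in moves by apply/movesP; left; exists e'.
have := connect_moves f mx my; rewrite /= !orbF => /connect_trans; apply.
exact: IHs st' lab.
Qed.

(** * From a cycle of pairs to an infinitely ambiguous observation *)

Lemma steps_of_move x o y : (x, o, y) \in moves ->
  exists2 s, steps x s y & labels s = oapp (cons^~ [::]) [::] o.
Proof.
case/movesP => [[e tr <-]|[-> ->]]; last by exists [::].
exists [:: e]; first by exists y.
by rewrite /labels /=; case: (label e).
Qed.

Lemma occurs_cat sg x s y : occurs sg x -> steps x s y -> occurs (sg ++ labels s) y.
Proof.
case=> x0 [s0 [ix <- st0]] st; exists x0, (s0 ++ s); split=> //.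
  by rewrite labels_cat.
by apply/steps_cat; exists x.
Qed.

(** The word is always read off the first component, whose moves form a genuine run. A reset is
    harmless because the first component is itself a possible state. Quantifying over [sg] lets a
    cycle be iterated. *)
Lemma connect_occurs u v : connect pair_edge u v ->
  exists s, [/\ steps u.1.1 s v.1.1, v.2 = u.2 || (labels s != [::])
    & forall sg, occurs sg u.1.1 -> occurs sg u.1.2 ->
        occurs (sg ++ labels s) v.1.1 /\ occurs (sg ++ labels s) v.1.2].
Proof.
case/connectP => p; elim: p u => [|w p IH] u /= => [_ ->|/andP[uw wp] ev].
  by exists [::]; rewrite orbF; split=> // sg; rewrite cats0.
have [s [st fl oc]] := IH w wp ev.
case/orP: uw => [/existsP[o /and3P[m1 m2 /eqP fo]]|/eqP wE]; last first.
  by exists s; rewrite wE /= in st fl oc; split=> // sg o1 o2; apply: oc.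
have [s1 st1 lab1] := steps_of_move m1; have [s2 st2 lab2] := steps_of_move m2.
exists (s1 ++ s); split.
- by apply/steps_cat; exists w.1.1.
- rewrite fl fo labels_cat lab1; case: (o) => [a|] /=; last by rewrite orbF.
  by rewrite !orbT.
move=> sg o1 o2; rewrite labels_cat catA; apply: oc; first exact: occurs_cat st1.
by rewrite lab1 -lab2; apply: occurs_cat st2.
Qed.

Lemma steps_states e0 x s y : steps x s y -> exists z : nat -> state S,
  [/\ z 0 = x, z (size s) = y &
      forall i, i < size s -> (z i, nth e0 s i, z i.+1) \in transition S].
Proof.
elim: s x => [|e s IH] x /= => [->|[w tr /IH[z [z0 zs zt]]]].
  by exists (fun=> y).
exists (fun i => if i is j.+1 then z j else x); split=> // -[|i] /=.
  by rewrite z0.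
exact: zt.
Qed.

Lemma labels_mkseqD (t : nat -> event S) m n :
  labels (mkseq t (m + n)) = labels (mkseq t m) ++ labels (mkseq (fun i => t (m + i)) n).
Proof.
rewrite -labels_cat; congr labels.
by rewrite /mkseq iotaD map_cat -[X in iota X n]addn0 iotaDl -map_comp.
Qed.

Lemma size_labels_mono (t : nat -> event S) m n : m <= n ->
  size (labels (mkseq t m)) <= size (labels (mkseq t n)).
Proof. by move/subnKC <-; rewrite labels_mkseqD size_cat leq_addr. Qed.

(** Output number [i] is read off a prefix long enough to contain it. Of two prefixes one extends
    the other, so the choice does not matter; [a0] is a default that is never reached. *)
Lemma omega_labels_exists (a0 : output S) (t : nat -> event S) :
  (forall n, exists m, n <= size (labels (mkseq t m))) ->
  exists sigma, omega_labels t sigma.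
Proof.
move=> unb; pose len n := projT1 (cid (unb n)).
have lenP n : n <= size (labels (mkseq t (len n))) by rewrite /len; case: cid.
exists (fun i => nth a0 (labels (mkseq t (len i.+1))) i); split=> // m /=.
apply: (@eq_from_nth _ a0) => [|i ltim]; first by rewrite size_mkseq.
rewrite nth_mkseq //; case: (leqP m (len i.+1)) => [|/ltnW] /subnKC <-.
  by rewrite labels_mkseqD nth_cat ltim.
by rewrite labels_mkseqD nth_cat lenP.
Qed.

Lemma undetectable_sound : undetectable -> ~ @eventually_strongly_detectable S.
Proof.
case=> x0 [y0 [q [r [ix iy qr /connect_occurs[s0 [/= st0 _ oc0]]]]]].
case/connect_occurs => s [/= st /esym nz oc] esd.
have nzl : 0 < size (labels s) by case: (labels s) nz.
have nzs : 0 < size s by case: (s) nzl.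
have e0 : event S by case: (s) nzs => // e; exact: e.
have a0 : output S by case: (labels s) nzl => // a; exact: a.
have [z0 [z00 z0s z0t]] := steps_states e0 st0.
have [z1 [z10 z1s z1t]] := steps_states e0 st.
(* The run is a lasso: [s0] once, then [s] forever. The index can wrap modulo [size s] because [z1]
   starts and ends at [q]. *)
pose t i := if i < size s0 then nth e0 s0 i else nth e0 s ((i - size s0) %% size s).
pose x i := if i < size s0 then z0 i else z1 ((i - size s0) %% size s).
have gen : generated t.
  exists x; split; rewrite /x.
    case: posnP => [s00|_]; last by rewrite z00.
    by rewrite sub0n mod0n z10 -z0s s00 z00.
  move=> i; rewrite /t; case: ltnP => [lti|lei].
    have := z0t i lti; move: lti; rewrite leq_eqVlt => /orP[/eqP ei|->//].
    by rewrite ei ltnn subnn mod0n z0s z10.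
  rewrite ltnNge (leq_trans lei (leqnSn i)) /= subSn //.
  set j := i - size s0; have ltj : j %% size s < size s by rewrite ltn_mod.
  have := z1t _ ltj; move: ltj; rewrite -(addn1 j) -modnDml addn1.
  rewrite leq_eqVlt => /orP[/eqP ->|ltj]; last by rewrite (modn_small ltj).
  by rewrite modnn z1s z10.
have lab0 : labels (mkseq t (size s0)) = labels s0.
  congr labels; apply: (@eq_from_nth _ e0); rewrite size_mkseq // => i lti.
  by rewrite nth_mkseq // /t lti.
have tk k : labels (mkseq t (size s0 + k * size s)) =
            labels s0 ++ flatten (nseq k (labels s)).
  elim: k => [|k IH]; first by rewrite mul0n addn0 cats0.
  rewrite mulSn addnCA addnC labels_mkseqD IH -addn1 nseqD flatten_cat /= cats0 catA.
  congr (_ ++ labels _); apply: (@eq_from_nth _ e0); rewrite size_mkseq // => i lti.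
  rewrite nth_mkseq // /t -addnA ltnNge leq_addr /= addKn.
  by rewrite modnMDl modn_small.
have szk k : size (flatten (nseq k (labels s))) = k * size (labels s).
  by rewrite size_flatten /shape map_nseq sumn_nseq mulnC.
have unb n : exists m, n <= size (labels (mkseq t m)).
  exists (size s0 + n * size s); rewrite tk size_cat szk.
  by apply: leq_trans (leq_addl _ _); rewrite leq_pmulr.
have [sigma om] := omega_labels_exists a0 unb.
have [|k _ det] := esd sigma; first by exists t.
(* Each round emits at least one output, so [k.+1] rounds exceed the bound [k]. *)
pose n := size (labels s0 ++ flatten (nseq k.+1 (labels s))).
have lt_kn : k < n.
  by rewrite /n size_cat szk; apply: leq_trans (leq_addl _ _); rewrite leq_pmulr.
have sgn : mkseq sigma n = labels s0 ++ flatten (nseq k.+1 (labels s)).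
  by have [/(_ (size s0 + k.+1 * size s))/= ] := om; rewrite tk => <-.
(* Each round appends [labels s] to the observation and keeps both [q] and [r] possible. *)
have occ j : occurs (labels s0 ++ flatten (nseq j (labels s))) q /\
             occurs (labels s0 ++ flatten (nseq j (labels s))) r.
  elim: j => [|j [oq or]].
    by rewrite cats0; apply: (oc0 [::]); [exists x0, [::]|exists y0, [::]].
  by rewrite -addn1 nseqD flatten_cat /= cats0 catA; apply: oc.
have /cards1P[w wE] : #|current_states (mkseq sigma n)| == 1 by rewrite det.
have [] := occ k.+1; rewrite -sgn => /current_statesP + /current_statesP.
by rewrite wE !inE => /eqP qw /eqP rw; rewrite qw rw eqxx in qr.
Qed.

(** * From an infinitely ambiguous observation to a cycle of pairs *)

Definition observes x (a : output S) y := exists2 s, steps x s y & labels s = [:: a].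

Lemma connect_observes x a x' y y' f : observes x a x' -> observes y a y' ->
  connect pair_edge (x, y, f) (x', y', true).
Proof.
move=> [s st lab] [s' st' lab'].
have := connect_steps f st st'; rewrite lab lab' orbT; exact.
Qed.

Lemma connect_run sigma n (xx yy : nat -> state S) f :
  (forall i, i < n -> observes (xx i) (sigma i) (xx i.+1)) ->
  (forall i, i < n -> observes (yy i) (sigma i) (yy i.+1)) ->
  forall i j, i < j <= n ->
    connect pair_edge (xx i, yy i, f) (xx j, yy j, true).
Proof.
move=> ox oy i j; elim: j => // j IH; rewrite ltnS leq_eqVlt andb_orl.
case/orP => /andP[].
  by move/eqP <- => ltn; apply: connect_observes (ox _ ltn) (oy _ ltn).
move=> lij ltj; apply: connect_trans (IH _) _; first by rewrite lij ltnW.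
exact: connect_observes (ox _ ltj) (oy _ ltj).
Qed.

(** The cut is made just before the event that emits the last output, so unobservable events
    following it stay in the last piece. *)
Lemma labels_rcons x s y sg a : steps x s y -> labels s = rcons sg a ->
  exists s1 z, [/\ steps x s1 z, labels s1 = sg & observes z a y].
Proof.
elim: s x sg => [|e s IH] x sg /=; first by case: sg.
case=> w tr st; case le: (label e) => [b|] /= lab; last first.
  have [s1 [z [st1 l1 o]]] := IH _ _ st lab.
  exists (e :: s1), z; split=> //; first by exists w.
  by rewrite /labels /= le.
case: sg lab => [|c sg] /= [bE lab].
  exists [::], x; split=> //; exists (e :: s); first by exists w.
  by rewrite /labels /= le bE /= -lab.
have [s1 [z [st1 l1 o]]] := IH _ _ st lab.
exists (e :: s1), z; split=> //; first by exists w.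
by rewrite /labels /= le bE /= -l1.
Qed.

(** Peeling off the last output [n] times leaves pieces of one output each; unobservable events
    before the first output remain in [s0]. *)
Lemma run_of_steps x s y sigma n : steps x s y -> labels s = mkseq sigma n ->
  exists yy : nat -> state S, [/\ yy n = y,
    exists2 s0, steps x s0 (yy 0) & labels s0 = [::] &
    forall i, i < n -> observes (yy i) (sigma i) (yy i.+1)].
Proof.
elim: n s y => [|n IH] s y st; first by exists (fun=> y); split=> //; exists s.
rewrite mkseqS => /(labels_rcons st)[s1 [z [st1 l1 o]]].
have [yy [yn y0 oy]] := IH _ _ st1 l1.
exists (fun i => if i <= n then yy i else y); split=> //; first by rewrite ltnn.
move=> i lei; rewrite (lei : i <= n); move: lei.
rewrite ltnS leq_eqVlt => /orP[/eqP ->|lti]; first by rewrite ltnn yn.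
by rewrite lti; apply: oy.
Qed.

Lemma steps_mkseq (t : nat -> event S) (x : nat -> state S) :
  (forall i, (x i, t i, x i.+1) \in transition S) ->
  forall n m, steps (x m) (mkseq (fun i => t (m + i)) n) (x (m + n)).
Proof.
move=> tr; elim=> [|n IH] m; first by rewrite addn0.
rewrite mkseqS -cats1; apply/steps_cat; exists (x (m + n)) => //=.
by exists (x (m + n).+1); rewrite ?addnS.
Qed.

Lemma infinite_run sigma : @omega_language S sigma ->
  exists x0 (xx : nat -> state S), [/\ x0 \in initial S,
    exists2 s0, steps x0 s0 (xx 0) & labels s0 = [::] &
    forall i, observes (xx i) (sigma i) (xx i.+1)].
Proof.
case=> t [x [ix tr]] [coh unb]; have st := steps_mkseq tr.
have ex n : exists m, size (labels (mkseq t m)) == n.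
  elim: n => [|n [m /eqP sm]]; first by exists 0.
  (* Before the first prefix with more than [n] outputs there are at most [n], and one event adds at
     most one, so no length is skipped. *)
  have [m' lt] := ex_minnP (unb n.+1); case: m' lt => // m' lt min.
  exists m'.+1; rewrite eqn_leq lt andbT.
  have : size (labels (mkseq t m')) <= n by rewrite leqNgt; apply/negP => /min; rewrite ltnn.
  rewrite mkseqS -cats1 labels_cat size_cat => le.
  rewrite -addn1 leq_add // /labels /=; by case: (label _).
pose p n := projT1 (cid (ex n)).
have pP n : labels (mkseq t (p n)) = mkseq sigma n.
  by rewrite /p; case: cid => m /= /eqP sm; have /= := coh m; rewrite sm.
have p_lt n : p n < p n.+1.
  rewrite ltnNge; apply/negP => /(size_labels_mono t).
  by rewrite !pP !size_mkseq ltnn.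
exists (x 0), (fun n => x (p n)); split=> //.
  exists (mkseq t (p 0)); [exact: st | exact: pP].
move=> i; exists (mkseq (fun j => t (p i + j)) (p i.+1 - p i)).
  by have := st (p i.+1 - p i) (p i); rewrite subnKC // ltnW.
have := pP i.+1; rewrite -{1}(subnKC (ltnW (p_lt i))) labels_mkseqD pP mkseqS -cats1.
by move/eqP; rewrite eqseq_cat // => /andP[_ /eqP].
Qed.

(** Otherwise each value is avoided from some index on, and the value taken at the maximum of these
    indices is a contradiction. *)
Lemma recurrent_value (T : finType) (xx : nat -> T) :
  exists q, forall N, exists2 i, N <= i & xx i = q.
Proof.
apply: contrapT => /forallNP nrec.
have bnd q : exists N, forall i, N <= i -> xx i != q.
  have /existsNP[N HN] := nrec q; exists N => i le.
  by apply/eqP => e; apply: HN; exists i.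
pose B q := projT1 (cid (bnd q)).
have BP q i : B q <= i -> xx i != q by rewrite /B; case: cid => N /= /(_ i).
pose M := \max_q B q; have := BP (xx M) M.
by rewrite eqxx => /(_ _)/negP; apply; rewrite //; apply: leq_bigmax.
Qed.

Lemma undetectable_complete : ~ @eventually_strongly_detectable S -> undetectable.
Proof.
case/existsNP => sigma /not_implyP[om /forall2NP nd].
have amb k : exists2 n, k < n & #|current_states (mkseq sigma n)| <> 1.
  have [//|/existsNP[n /not_implyP[lt ne]]] := nd k.+1.
  by exists n => //; apply: ltnW.
have [x0 [xx [ix [sx stx lsx] ox]]] := infinite_run om.
have [q rec] := recurrent_value xx.
pose nxt N := s2val (cid2 (rec N)).
have nxtP N : N <= nxt N /\ xx (nxt N) = q by rewrite /nxt; case: cid2.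
(* [f] lists visits of the run [xx] to the recurrent state [q] in increasing order. *)
pose f := fix f k := if k is k'.+1 then nxt (f k').+1 else nxt 0.
have fS k : f k < f k.+1 by apply: (nxtP _).1.
have fmono i j : i < j -> f i < f j.
  by elim: j => // j IH; rewrite ltnS leq_eqVlt => /orP[/eqP -> //|/IH/ltn_trans]; apply.
have fq k : xx (f k) = q by case: k => [|k]; apply: (nxtP _).2.
pose K := #|state S|.
have occx m : occurs (mkseq sigma m) (xx m).
  elim: m => [|m [x1 [s [ix1 ls st]]]]; first by exists x0, sx.
  have [s' st' ls'] := ox m; exists x1, (s ++ s'); split=> //.
    by rewrite labels_cat ls ls' mkseqS cats1.
  by apply/steps_cat; exists (xx m).
have [n ltn ne1] := amb (f K).
(* The run itself makes [xx n] possible, so a number of current states other than 1 yields a second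
   one. *)
have [y cy yx] : exists2 y, occurs (mkseq sigma n) y & y != xx n.
  apply: contrapT => /forall2NP H; apply: ne1; apply/eqP/cards1P; exists (xx n).
  apply/setP => y; rewrite inE; apply/idP/eqP => [|->]; last exact/current_statesP.
  by move/current_statesP => oc; case: (H y) => [//|/negP/negbNE/eqP].
have [y0 [sy [iy lsy sty]]] := cy.
have [yy [yn [sy0 sty0 lsy0] oy]] := run_of_steps sty lsy.
have oxn i : i < n -> observes (xx i) (sigma i) (xx i.+1) by [].
(* The flag starts at [true], as in the reachability part of [undetectable]. *)
have reach j : 0 < j <= n -> connect pair_edge (x0, y0, true) (xx j, yy j, true).
  move=> lej; have := connect_steps true stx sty0; rewrite lsx lsy0 => /(_ erefl).
  by move/connect_trans; apply; apply: connect_run lej.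
(* If the run to [y] is in [q] at visit [k], the ambiguous pair is [(xx n, y)]: reset to
   [(xx n, xx n)], follow [xx] to a later visit [(q, q)], then replay the stretch from [f k] to [n]
   along [xx] and [yy]. *)
have [[k lek ek]|nq] := pselect (exists2 k, k <= K & yy (f k) = q).
  have ltf : f k < n.
    by apply: leq_ltn_trans ltn; move: lek; rewrite leq_eqVlt => /orP[/eqP ->|/fmono/ltnW].
  exists x0, y0, (xx n), y; split=> //; first by rewrite eq_sym.
    by rewrite -yn; apply: reach; rewrite leqnn (leq_ltn_trans _ ltf).
  apply: connect_trans (connect_reset _ _ _) _.
  have [ln nq] := nxtP n.+1.
  apply: (@connect_trans _ _ (q, q, true)).
    rewrite -nq; apply: (connect_run (n := nxt n.+1) (sigma := sigma)) => //.
    by rewrite ln leqnn.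
  by rewrite -{1}(fq k) -ek -yn; apply: (connect_run _ oxn oy); rewrite ltf leqnn.
(* Otherwise there are [K.+1] visits for [K] states, so [yy] takes the same value at two of them.
   All these visits precede [n], and the value differs from [q]. *)
pose g (k : 'I_K.+1) := yy (f k).
have /injectivePn[k1 [k2 ne g12]] : ~~ injectiveb g.
  by apply/negP => /injectiveP/leq_card; rewrite card_ord ltnn.
wlog lt12 : k1 k2 ne g12 / k1 < k2.
  move=> W; have : k1 != k2 :> nat by [].
  by rewrite neq_ltn => /orP[/(W _ _ ne g12)|/W]; apply => //; rewrite eq_sym.
have ltf := fmono _ _ lt12.
have lef2 : f k2 <= n.
  apply: ltnW; apply: leq_ltn_trans ltn; have := ltn_ord k2.
  by rewrite ltnS leq_eqVlt => /orP[/eqP ->|/fmono/ltnW].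
exists x0, y0, q, (g k2); split=> //.
- by apply/eqP => e; apply: nq; exists k2; [rewrite -ltnS|rewrite e].
- by rewrite -(fq k2); apply: reach; rewrite lef2 (leq_ltn_trans _ ltf).
- rewrite -{1}g12 -{1}(fq k1) -(fq k2); apply: (connect_run _ oxn oy).
  by rewrite ltf lef2.
Qed.

Lemma undetectableP : @eventually_strongly_detectable S <-> ~ undetectable.
Proof.
split=> [esd /undetectable_sound //|nu].
by apply: contrapT => /undetectable_complete.
Qed.

End Criterion.

(** * A language of bounded loops and its compilation *)

Inductive expr :=
  | EConst of nat
  | EVar of nat
  | EAdd of expr & expr
  | ESub of expr & expr
  | ELoad of nat & expr.

Inductive cmd :=
  | CStore of nat & expr & expr
  | CRead of nat & expr
  | CSeq of cmd & cmd
  | CIf of expr & cmd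
  | CFor of nat & nat & cmd.

Definition memory := nat -> nat -> nat.

Definition store (m : memory) (a i v : nat) : memory :=
  fun a' i' => if (a' == a) && (i' == i) then v else m a' i'.

Fixpoint eval (rho : nat -> nat) (m : memory) (e : expr) : nat :=
  match e with
  | EConst n => n
  | EVar i => rho i
  | EAdd e1 e2 => eval rho m e1 + eval rho m e2
  | ESub e1 e2 => eval rho m e1 - eval rho m e2
  | ELoad a e => m a (eval rho m e)
  end.

(* Variables are bound by loops only, so no variable ever exceeds the initial
   ones: the running time is then bounded by the nesting of the loops. *)
Fixpoint exec (c : cmd) (rho : nat -> nat) (s : memory * seq nat) :
    memory * seq nat :=
  match c with
  | CStore a e1 e2 => (store s.1 a (eval rho s.1 e1) (eval rho s.1 e2), s.2)
  | CRead a e => (store s.1 a (eval rho s.1 e) (head 0 s.2), behead s.2)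
  | CSeq c1 c2 => exec c2 rho (exec c1 rho s)
  | CIf e c => if 0 < eval rho s.1 e then exec c rho s else s
  | CFor i k c => foldl (fun s j => exec c (upd rho i j) s) s (iota 0 (rho k))
  end.

(* The registers are shared out by residues modulo 16: arrays have residues
   below 12, the remaining classes hold temporaries, variables and constants. *)
Definition areg a i := i * 16 + a.
Definition tmp d := areg 12 d.
Definition vreg i := areg 13 i.
Definition zero := areg 14 0.
Definition one := areg 14 1.

Fixpoint wf_expr (vs : seq nat) (e : expr) : bool :=
  match e with
  | EConst _ => true
  | EVar i => i \in vs
  | EAdd e1 e2 | ESub e1 e2 => wf_expr vs e1 && wf_expr vs e2
  | ELoad a e => (a < 12) && wf_expr vs e
  end.

(* A loop keeps its counter in its variable, hence [i \notin vs]. *)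
Fixpoint wf (vs : seq nat) (c : cmd) : bool :=
  match c with
  | CStore a e1 e2 => [&& a < 12, wf_expr vs e1 & wf_expr vs e2]
  | CRead a e => (a < 12) && wf_expr vs e
  | CSeq c1 c2 => wf vs c1 && wf vs c2
  | CIf e c => wf_expr vs e && wf vs c
  | CFor i k c => [&& i \notin vs, k \in vs & wf (i :: vs) c]
  end.

(** Four doublings multiply the index by 16, as the machine has no multiplication; the array number
    is then added. *)
Definition addr_code a d : program :=
  nseq 4 (IAdd (tmp d) (tmp d) (tmp d)) ++
  [:: IConst (tmp d.+1) a; IAdd (tmp d) (tmp d) (tmp d.+1)].

(** The temporaries serve as a stack: the value ends up in [tmp d], and temporaries below level [d]
    are preserved. *)
Fixpoint expr_code (e : expr) (d : nat) : program :=
  match e with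
  | EConst n => [:: IConst (tmp d) n]
  | EVar i => [:: IAdd (tmp d) (vreg i) zero]
  | EAdd e1 e2 =>
    expr_code e1 d ++ expr_code e2 d.+1 ++ [:: IAdd (tmp d) (tmp d) (tmp d.+1)]
  | ESub e1 e2 =>
    expr_code e1 d ++ expr_code e2 d.+1 ++ [:: ISub (tmp d) (tmp d) (tmp d.+1)]
  | ELoad a e => expr_code e d ++ addr_code a d ++ [:: ILoad (tmp d) (tmp d)]
  end.

(** Jump targets are absolute, hence the address [o] of the first instruction. As register [one] is
    positive, [IJpos one] is an unconditional jump. *)
Fixpoint code (o : nat) (c : cmd) : program :=
  match c with
  | CStore a e1 e2 =>
    expr_code e1 0 ++ addr_code a 0 ++ expr_code e2 1
    ++ [:: IStore (tmp 0) (tmp 1)]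
  | CRead a e =>
    expr_code e 0 ++ addr_code a 0 ++ [:: IRead (tmp 1); IStore (tmp 0) (tmp 1)]
  | CSeq c1 c2 => let p := code o c1 in p ++ code (o + size p) c2
  | CIf e c =>
    let p := expr_code e 0 in
    let q := code (o + size p).+2 c in
    p ++ [:: IJpos (tmp 0) (o + size p).+2; IJpos one ((o + size p).+2 + size q)]
    ++ q
  | CFor i k c =>
    let q := code (o + 4) c in
    [:: IConst (vreg i) 0; ISub (tmp 0) (vreg k) (vreg i);
        IJpos (tmp 0) (o + 4); IJpos one (o + 4 + size q + 2)]
    ++ q ++ [:: IAdd (vreg i) (vreg i) one; IJpos one o.+1]
  end.

(* Bounds the number of instructions executed when every variable is at most
   [s]. *)
Fixpoint time (c : cmd) (s : nat) : nat :=
  match c with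
  | CStore _ _ _ | CRead _ _ => size (code 0 c)
  | CSeq c1 c2 => time c1 s + time c2 s
  | CIf e c => size (expr_code e 0) + 2 + time c s
  | CFor _ _ c => s * (time c s + 4) + 4
  end.

(** * Runs of the machine and correctness of the compiled code *)

Inductive run (P : program) : nat -> config -> config -> Prop :=
  | run0 c : run P 0 c c
  | runS c c' c'' I n : onth P (pc c) = Some I -> exec_instr I c = Some c' ->
      run P n c' c'' -> run P n.+1 c c''.

Lemma run_step P o r w I c n c' : onth P o = Some I ->
  exec_instr I (Config o r w) = Some c -> run P n c c' -> run P n.+1 (Config o r w) c'.
Proof. exact: (@runS P (Config o r w)). Qed.

Lemma run_trans P n1 n2 c1 c2 c3 :
  run P n1 c1 c2 -> run P n2 c2 c3 -> run P (n1 + n2) c1 c3.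
Proof.
elim=> [//|c c' c'' I n oP ex _ IH r]; rewrite addSn.
by apply: runS oP ex _; apply: IH.
Qed.

Definition code_at (P : program) (o : nat) (Q : program) : Prop :=
  forall i, i < size Q -> onth P (o + i) = onth Q i.

Lemma code_at_cat P o Q1 Q2 :
  code_at P o (Q1 ++ Q2) -> code_at P o Q1 /\ code_at P (o + size Q1) Q2.
Proof.
move=> at12; split=> i lti; first by rewrite at12 ?size_cat ?ltn_addr // onth_cat lti.
by rewrite -addnA at12 ?size_cat ?ltn_add2l // onth_cat ltnNge leq_addr /= addKn.
Qed.

Lemma code_at_hd P o I Q : code_at P o (I :: Q) -> onth P o = Some I /\ code_at P o.+1 Q.
Proof.
move=> oc; split; first by have := oc 0 isT; rewrite addn0.
by move=> i lti; have := oc i.+1 lti; rewrite addnS.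
Qed.

(* The evaluation of an expression at level [d] changes such registers only. *)
Definition scratch d r := exists2 d', d <= d' & r = tmp d'.

Definition agree (vs : seq nat) (rho : nat -> nat) (m : memory) (r : nat -> nat) :=
  [/\ forall a i, a < 12 -> r (areg a i) = m a i,
      forall i, i \in vs -> r (vreg i) = rho i, r zero = 0 & r one = 1].

Lemma areg_inj a a' i i' : a < 16 -> a' < 16 -> areg a i = areg a' i' -> a = a' /\ i = i'.
Proof. rewrite /areg; lia. Qed.

Lemma agree_scratch vs rho m r r' d : agree vs rho m r ->
  (forall x, r' x = r x \/ scratch d x) -> agree vs rho m r'.
Proof.
case=> ra rv r0 r1 rr'.
have E a i : a != 12 -> a < 16 -> r' (areg a i) = r (areg a i).
  move=> ne lt; case: (rr' (areg a i)) => // -[d' _] /areg_inj-[] // e.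
  by rewrite e eqxx in ne.
split=> [a i lt|i iv||]; rewrite E //; [exact: ra| |exact: ltn_trans lt _|exact: rv].
by rewrite neq_ltn lt.
Qed.

(** Meant for code without jumps: it works at any address, executes each instruction once, and
    leaves at its end. *)
Definition block Q r w r' w' := forall P o, code_at P o Q ->
  run P (size Q) (Config o r w) (Config (o + size Q) r' w').

Lemma block_cat Q1 Q2 r1 w1 r2 w2 r3 w3 :
  block Q1 r1 w1 r2 w2 -> block Q2 r2 w2 r3 w3 -> block (Q1 ++ Q2) r1 w1 r3 w3.
Proof.
move=> b1 b2 P o /code_at_cat[c1 c2]; rewrite size_cat addnA.
by apply: run_trans (b1 _ _ c1) (b2 _ _ c2).
Qed.

Lemma block1 I r w r' w' :
  (forall p, exec_instr I (Config p r w) = Some (Config p.+1 r' w')) ->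
  block [:: I] r w r' w'.
Proof.
move=> ex P o /code_at_hd[oc _]; apply: run_step oc (ex o) _.
by rewrite addn1; apply: run0.
Qed.

Lemma upd_same (r : nat -> nat) x v : upd r x v x = v.
Proof. by rewrite /upd eqxx. Qed.

Lemma scratch_upd d d' (r : nat -> nat) x v : d <= d' -> upd r (tmp d') v x = r x \/ scratch d x.
Proof. by move=> le; rewrite /upd; case: eqP => [->|_]; [right; exists d'|left]. Qed.

Lemma scratch_trans d d' (r1 r2 r3 : nat -> nat) : d <= d' ->
  (forall x, r2 x = r1 x \/ scratch d x) -> (forall x, r3 x = r2 x \/ scratch d' x) ->
  forall x, r3 x = r1 x \/ scratch d x.
Proof.
move=> le h12 h23 x; case: (h23 x) => [->|[d2 le2 ->]]; first exact: h12.
by right; exists d2 => //; apply: leq_trans le2.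
Qed.

Lemma scratch_below d d' (r r' : nat -> nat) : (forall x, r' x = r x \/ scratch d x) -> d' < d ->
  r' (tmp d') = r (tmp d').
Proof.
move=> h lt; case: (h (tmp d')) => // -[d2 le /areg_inj-[] // _ e].
by move: lt; rewrite ltnNge e le.
Qed.

Lemma tmpS_neq d : (tmp d == tmp d.+1) = false.
Proof. by apply/eqP => /areg_inj-[] // _; lia. Qed.

Lemma addr_code_block a d r w : exists r',
  [/\ block (addr_code a d) r w r' w, r' (tmp d) = areg a (r (tmp d))
    & forall x, r' x = r x \/ scratch d x].
Proof.
pose dbl r := upd r (tmp d) (r (tmp d) + r (tmp d)).
have dblP r1 : block [:: IAdd (tmp d) (tmp d) (tmp d)] r1 w (dbl r1) w by apply: block1.
pose r4 := dbl (dbl (dbl (dbl r))).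
exists (upd (upd r4 (tmp d.+1) a) (tmp d) (upd r4 (tmp d.+1) a (tmp d) + a)); split.
- rewrite /addr_code; apply: (@block_cat _ _ _ _ r4 w).
    by do 3!(apply: (block_cat (dblP _))); apply: dblP.
  apply: (@block_cat [:: _] [:: _] _ _ (upd r4 (tmp d.+1) a) w); apply: block1 => // p.
  by rewrite /= upd_same.
- rewrite upd_same {1}/upd tmpS_neq /r4 /dbl !upd_same /areg; lia.
- have dblS r1 x : dbl r1 x = r1 x \/ scratch d x by apply: scratch_upd.
  have S4 x : r4 x = r x \/ scratch d x.
    by do 3!(apply: (scratch_trans (leqnn d) _ (dblS _))); apply: dblS.
  apply: (scratch_trans (leqnn d) _ (fun x => scratch_upd _ _ _ _)) => //.
  by apply: (scratch_trans (leqnn d) S4 (fun x => scratch_upd _ _ _ _)) => //.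
Qed.

Lemma expr_code_block vs e d rho m r w : wf_expr vs e -> agree vs rho m r ->
  exists r', [/\ block (expr_code e d) r w r' w,
    r' (tmp d) = eval rho m e & forall x, r' x = r x \/ scratch d x].
Proof.
elim: e d r => [n|i|e1 IH1 e2 IH2|e1 IH1 e2 IH2|a e IH] d r /=.
- move=> _ ag; exists (upd r (tmp d) n); split; first exact: block1.
    by rewrite upd_same.
  by move=> x; apply: scratch_upd.
- move=> iv [_ rv r0 _]; exists (upd r (tmp d) (rho i)); split.
  + by apply: block1 => p; rewrite /= r0 rv // addn0.
  + by rewrite upd_same.
  + by move=> x; apply: scratch_upd.
- case/andP => wf1 wf2 ag; have [r1 [b1 v1 s1]] := IH1 d r wf1 ag.
  have [r2 [b2 v2 s2]] := IH2 d.+1 r1 wf2 (agree_scratch ag s1).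
  exists (upd r2 (tmp d) (eval rho m e1 + eval rho m e2)); split.
  + apply: block_cat b1 _; apply: block_cat b2 _; apply: block1 => p.
    by rewrite /= (scratch_below s2) // v1 v2.
  + by rewrite upd_same.
  + apply: (scratch_trans (leqnn d) _ (fun x => scratch_upd _ _ _ _)) => //.
    exact: (scratch_trans (leqnSn d) s1 s2).
- case/andP => wf1 wf2 ag; have [r1 [b1 v1 s1]] := IH1 d r wf1 ag.
  have [r2 [b2 v2 s2]] := IH2 d.+1 r1 wf2 (agree_scratch ag s1).
  exists (upd r2 (tmp d) (eval rho m e1 - eval rho m e2)); split.
  + apply: block_cat b1 _; apply: block_cat b2 _; apply: block1 => p.
    by rewrite /= (scratch_below s2) // v1 v2.
  + by rewrite upd_same.
  + apply: (scratch_trans (leqnn d) _ (fun x => scratch_upd _ _ _ _)) => //.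
    exact: (scratch_trans (leqnSn d) s1 s2).
- case/andP => alt wfe ag; have [r1 [b1 v1 s1]] := IH d r wfe ag.
  have [r2 [b2 v2 s2]] := addr_code_block a d r1 w.
  have s12 := scratch_trans (leqnn d) s1 s2.
  exists (upd r2 (tmp d) (r2 (r2 (tmp d)))); split.
  + by apply: block_cat b1 _; apply: block_cat b2 _; apply: block1.
  + by rewrite upd_same v2 v1; have [-> ] := agree_scratch ag s12.
  + by apply: (scratch_trans (leqnn d) s12 (fun x => scratch_upd _ _ _ _)).
Qed.

Lemma agree_store vs rho m r a i v : a < 12 -> agree vs rho m r ->
  agree vs rho (store m a i v) (upd r (areg a i) v).
Proof.
move=> alt [ra rv r0 r1].
have E a' i' : 12 <= a' < 16 -> upd r (areg a i) v (areg a' i') = r (areg a' i').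
  by move=> lta; rewrite /upd; case: eqP => // /areg_inj-[]; lia.
split=> [a' i' lta|i' iv||]; try by rewrite E ?rv.
rewrite /upd /store -ra //; case: (areg a' i' =P areg a i) => [e|ne].
  have [||-> ->] := areg_inj _ _ e; [lia|lia|by rewrite !eqxx].
by case: eqP => // aE; case: eqP => // iE; case: ne; rewrite aE iE.
Qed.

Lemma code_run s c vs rho m r w m' w' P o :
  wf vs c -> (forall i, i \in vs -> rho i <= s) -> agree vs rho m r ->
  exec c rho (m, w) = (m', w') -> code_at P o (code o c) ->
  exists k r', [/\ k <= time c s,
    run P k (Config o r w) (Config (o + size (code o c)) r' w')
    & agree vs rho m' r'].
Proof.
elim: c vs rho m r w m' w' o => [a e1 e2|a e|c1 IH1 c2 IH2|e c IH|i k c IH]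
  vs rho m r w m' w' o.
- case/and3P => alt wf1 wf2 les ag [<- <-] at0.
  have [r1 [b1 v1 s1]] := expr_code_block 0 w wf1 ag.
  have [r2 [b2 v2 s2]] := addr_code_block a 0 r1 w.
  have s12 := scratch_trans (leqnn _) s1 s2.
  have [r3 [b3 v3 s3]] := expr_code_block 1 w wf2 (agree_scratch ag s12).
  have s13 := scratch_trans (leq0n _) s12 s3.
  exists (size (code o (CStore a e1 e2))), (upd r3 (r3 (tmp 0)) (r3 (tmp 1))); split=> //.
    apply: (block_cat b1 (block_cat b2 (block_cat b3 _))) at0.
    exact: block1.
  rewrite v3 (scratch_below s3) // v2 v1; apply: agree_store => //.
  exact: agree_scratch ag s13.
- case/andP => alt wfe les ag [<- <-] at0.
  have [r1 [b1 v1 s1]] := expr_code_block 0 w wfe ag.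
  have [r2 [b2 v2 s2]] := addr_code_block a 0 r1 w.
  have s12 := scratch_trans (leqnn _) s1 s2.
  pose r3 := upd r2 (tmp 1) (head 0 w).
  have s3 x : r3 x = r2 x \/ scratch 1 x by apply: scratch_upd.
  have s13 := scratch_trans (leq0n _) s12 s3.
  exists (size (code o (CRead a e))), (upd r3 (r3 (tmp 0)) (r3 (tmp 1))); split=> //.
    apply: (block_cat b1 (block_cat b2 (@block_cat [:: _] [:: _] _ _ r3 (behead w) _ _ _ _))) at0.
      exact: block1.
    exact: block1.
  rewrite (scratch_below s3) // v2 v1 {2}/r3 upd_same; apply: agree_store => //.
  exact: agree_scratch ag s13.
- move=> /= /andP[wf1 wf2] les ag ex /code_at_cat[at1 at2].
  case ex1: (exec c1 rho (m, w)) ex => [m1 w1] ex2.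
  have [k1 [r1 [le1 run1 ag1]]] := IH1 _ _ _ _ _ _ _ _ wf1 les ag ex1 at1.
  have [k2 [r2 [le2 run2 ag2]]] := IH2 _ _ _ _ _ _ _ _ wf2 les ag1 ex2 at2.
  exists (k1 + k2), r2; split=> //; first exact: leq_add.
  by rewrite size_cat addnA; apply: run_trans run1 run2.
- move=> /= /andP[wfe wfc] les ag ex /code_at_cat[at1].
  set o1 := o + size _ in at1 * => /code_at_hd[oc1 /code_at_hd[oc2 at2]].
  have [r1 [b1 v1 s1]] := expr_code_block 0 w wfe ag.
  have ag1 := agree_scratch ag s1; have run1 := b1 _ _ at1.
  rewrite size_cat /= addnA -/o1.
  have -> x : o1 + x.+2 = o1.+2 + x by lia.
  case: ifP ex => [pos ex|npos [<- <-]].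
    have [k [r' [le run2 ag2]]] := IH _ _ _ _ _ _ _ _ wfc les ag1 ex at2.
    exists (size (expr_code e 0) + k.+1), r'; split=> //; first by lia.
    by apply: run_trans run1 (run_step oc1 _ run2); rewrite /= v1 pos.
  exists (size (expr_code e 0) + 2), r1; split=> //; first by lia.
  apply: run_trans run1 (run_step oc1 _ (run_step oc2 _ (run0 _ _))) => //=.
    by rewrite v1 npos.
  by have [_ _ _ ->] := ag1.
- rewrite /= => /and3P[iv kv wfc] les ag; set Q := code _ c.
  move=> ex /code_at_hd[oc1 /code_at_hd[oc2 /code_at_hd[oc3 /code_at_hd[oc4]]]].
  rewrite -[o.+4]addn4 => /code_at_cat[atQ /code_at_hd[oc5 /code_at_hd[oc6 _]]].
  (* The loop is entered after the counter has been set to [j], with [n] iterations left. An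
     iteration costs its body and four instructions (two for the test, two to increment and jump
     back); the exit costs three. *)
  have loop n : forall j m1 r1 w1, j + n = rho k -> agree vs rho m1 r1 ->
      r1 (vreg i) = j ->
      foldl (fun s j => exec c (upd rho i j) s) (m1, w1) (iota j n) = (m', w') ->
    exists l r', [/\ l <= n * (time c s + 4) + 3,
      run P l (Config o.+1 r1 w1) (Config (o + 4 + size Q + 2) r' w') &
      agree vs rho m' r'].
    elim: n => [|n IHn] j m1 r1 w1 jn ag1 rj; pose r2 := upd r1 (tmp 0) (rho k - j);
      have e2 : exec_instr (ISub (tmp 0) (vreg k) (vreg i)) (Config o.+1 r1 w1)
                     = Some (Config o.+2 r2 w1)
             by case: ag1 => _ rv _ _; rewrite /= rv // rj.
      move=> /= [<- <-]; exists 3, r2.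
      have ag2 : agree vs rho m1 r2.
        exact: agree_scratch ag1 (fun x => scratch_upd _ _ _ (leqnn 0)).
      split=> //; apply: run_step oc2 e2 _.
      apply: run_step oc3 _ _; first by rewrite /= {1}/r2 upd_same (_ : rho k - j = 0) //; lia.
      apply: run_step oc4 _ (run0 _ _).
      by case: ag2 => _ _ _ /= ->.
    move=> /=; case ex1: (exec c (upd rho i j) (m1, w1)) => [m2 w2] ex2.
    (* In the body [i] is a new variable with value [j]; since [i] is not in [vs], the outer
       variables keep their values. *)
    have ag2 : agree (i :: vs) (upd rho i j) m1 r2.
      have [ra rv r0 r1E] : agree vs rho m1 r2.
        exact: agree_scratch ag1 (fun x => scratch_upd _ _ _ (leqnn 0)).
      split=> // x; rewrite inE => /orP[/eqP ->|xv]; rewrite /upd.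
        by rewrite eqxx /r2 /upd; case: eqP => // /areg_inj-[].
      by case: eqP => [xi|_]; [rewrite -xi xv in iv | apply: rv].
    have les2 x : x \in i :: vs -> upd rho i j x <= s.
      rewrite inE /upd; case: eqP => [_ _|_ /= /les //].
      by apply: leq_trans (les k kv); rewrite -jn leq_addr.
    have [l [r3 [lel run3 ag3]]] := IH _ _ _ _ _ _ _ _ wfc les2 ag2 ex1 atQ.
    pose r4 := upd r3 (vreg i) j.+1.
    (* The body leaves the counter alone: [i] is in scope there, so no inner loop can reuse it. *)
    have rj3 : r3 (vreg i) = j by have [_ -> //] := ag3; rewrite ?inE ?eqxx ?upd_same.
    have ag4 : agree vs rho m2 r4.
      have [ra rv r0 r1E] := ag3.
      have E a x : vreg i != areg a x -> r4 (areg a x) = r3 (areg a x).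
        by rewrite /r4 /upd eq_sym => /negbTE ->.
      split=> [a x lta|x xv||]; rewrite E //; try (by apply/eqP => /areg_inj-[]; lia).
      - exact: ra.
      - rewrite rv ?inE ?xv ?orbT // /upd; case: eqP => // xi.
        by rewrite -xi xv in iv.
      - by apply/eqP => /areg_inj-[] // _ xi; rewrite xi xv in iv.
    have [l' [r' [lel' run' ag']]] := IHn j.+1 m2 r4 w2 (etrans (addSnnS _ _) jn) ag4
      (upd_same _ _ _) ex2.
    exists (2 + (l + (2 + l'))), r'; split=> //; first by rewrite mulSn; lia.
    apply: run_step oc2 e2 _.
    apply: run_step oc3 _ _; first by rewrite /= {1}/r2 upd_same (_ : 0 < rho k - j) //; lia.
    apply: run_trans run3 _; apply: run_step oc5 _ _.
      by case: ag3 => _ _ _ r1E; rewrite /= rj3 r1E addn1.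
    apply: run_step oc6 _ run'; by case: ag4 => _ _ _; rewrite /= /r4 => ->.
  have [|||l [r' [lel run' ag']]] := loop (rho k) 0 m (upd r (vreg i) 0) w _ _ _ ex; first by [].
  - case: ag => ra rv r0 r1.
    have E a x : vreg i != areg a x -> upd r (vreg i) 0 (areg a x) = r (areg a x).
      by rewrite /upd eq_sym => /negbTE ->.
    split=> [a x lta|x xv||]; rewrite E //; try (by apply/eqP => /areg_inj-[]; lia).
    + exact: ra.
    + exact: rv.
    by apply/eqP => /areg_inj-[] // _ xi; rewrite xi xv in iv.
  - exact: upd_same.
  exists l.+1, r'; split=> //.
    by have := leq_mul (les k kv) (leqnn (time c s + 4)); lia.
  rewrite size_cat /= (_ : o + _ = o + 4 + size Q + 2); last by lia.
  exact: run_step oc1 _ run'.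
Qed.

(** * Logarithmic cost of a run *)

Definition bits_bounded (w : nat) (c : config) :=
  (forall i, reg c i < 2 ^ w) /\ all (fun a => a < 2 ^ w) (tape c).

Definition small_const (w : nat) (I : instr) : bool :=
  if I is IConst _ a then a < 2 ^ w else true.

Lemma all_onth T (p : pred T) s i x : all p s -> onth s i = Some x -> p x.
Proof. by elim: s i => [|y s IH] [|i] //= /andP[py ps]; [case=> <-|apply: IH]. Qed.

Lemma bitlen_le n w : n < 2 ^ w -> bitlen n <= w.+1.
Proof.
move=> lt; rewrite /bitlen ltnS; case: n lt => [|n] lt; first by rewrite trunc_log0.
by rewrite ltnW // -(ltn_exp2l _ _ (isT : 1 < 2)); apply: leq_ltn_trans lt; apply: trunc_logP.
Qed.

Lemma upd_lt r i v b : v < b -> (forall j, r j < b) -> forall j, upd r i v j < b.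
Proof. by move=> vb rb j; rewrite /upd; case: eqP. Qed.

(* One instruction at most doubles the largest number in store. *)
Lemma step_bits P w c c' I : onth P (pc c) = Some I -> exec_instr I c = Some c' ->
  all (small_const w) P -> bits_bounded w c ->
  bits_bounded w.+1 c' /\ cost I c <= 2 * w.+1.
Proof.
move=> oP ex cP [rb tb]; have := all_onth cP oP.
have ww x : x < 2 ^ w -> x < 2 ^ w.+1 by rewrite expnS; lia.
have add_lt x y : x < 2 ^ w -> y < 2 ^ w -> x + y < 2 ^ w.+1 by rewrite expnS; lia.
have tb1 : all (fun a => a < 2 ^ w.+1) (tape c) by apply: sub_all tb.
have rb1 i : reg c i < 2 ^ w.+1 by apply: ww.
have hb : head 0 (tape c) < 2 ^ w.
  by case: (tape c) tb => [|a l] /= => [_|/andP[]//]; rewrite expn_gt0.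
have bb : all (fun a => a < 2 ^ w.+1) (behead (tape c)).
  by case: (tape c) tb1 => [|a l] //= /andP[].
have bl x : x < 2 ^ w -> bitlen x <= 2 * w.+1 by move/bitlen_le; lia.
have bl2 x y : x < 2 ^ w -> y < 2 ^ w -> bitlen x + bitlen y <= 2 * w.+1.
  by move=> /bitlen_le ? /bitlen_le; lia.
case: c oP ex rb tb tb1 rb1 hb bb => [p m t] oP ex rb tb tb1 rb1 hb bb.
case: I ex oP => [i a|i j k|i j k|i j|i j|i|j l|b] //= [<-] oP ca; split=> //=;
  try exact: bl2; try exact: bl; split=> //=; apply: upd_lt => //; try exact: ww.
  exact: add_lt.
by apply: ww; apply: leq_ltn_trans (leq_subr _ _) _.
Qed.

(** The width grows by at most one bit per instruction, so it never exceeds [w + n]; the final 1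
    pays for the halt. *)
Lemma run_halts P n w c c' b : run P n c c' -> onth P (pc c') = Some (IHalt b) ->
  all (small_const w) P -> bits_bounded w c ->
  exists2 N, halts_with P c b N & N <= n * (2 * (w + n).+1) + 1.
Proof.
move=> r hlt; elim: r w hlt => {n c c'} [c|c c1 c2 I n oP ex _ IH] w hlt cP bc.
  by exists (cost (IHalt b) c); [exact: halts_now | case: c {hlt bc}].
have [bc1 costI] := step_bits oP ex cP bc.
have cP1 : all (small_const w.+1) P.
  by apply: sub_all cP => -[] // i a /= /ltn_trans; apply; rewrite ltn_exp2l.
have [N hN leN] := IH _ hlt cP1 bc1.
exists (cost I c + N); first exact: halts_later hN.
rewrite mulSn -addnA leq_add //; first by lia.
by apply: leq_trans leN _; rewrite leq_add2r leq_mul2l; apply/orP; right; lia.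
Qed.

(** * Polynomial bounds and the assembled machine program *)

Definition poly_bounded (f : nat -> nat) := exists p : {poly nat}, forall s, f s <= p.[s]%R.

Lemma poly_bounded_const k : poly_bounded (fun=> k).
Proof. by exists (k%:P)%R => s; rewrite hornerC. Qed.

Lemma poly_bounded_id : poly_bounded id.
Proof. by exists 'X%R => s; rewrite hornerX. Qed.

Lemma poly_bounded_add f g : poly_bounded f -> poly_bounded g ->
  poly_bounded (fun s => f s + g s).
Proof.
case=> p hp [q hq]; exists (p + q)%R => s; rewrite hornerD.
exact: leq_add (hp s) (hq s).
Qed.

Lemma poly_bounded_mul f g : poly_bounded f -> poly_bounded g ->
  poly_bounded (fun s => f s * g s).
Proof.
case=> p hp [q hq]; exists (p * q)%R => s; rewrite hornerM.
exact: leq_mul (hp s) (hq s).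
Qed.

Lemma poly_bounded_time c f : poly_bounded f -> poly_bounded (fun s => time c (f s)).
Proof.
move=> pi; have pc := poly_bounded_const.
have pa := poly_bounded_add; have pm := poly_bounded_mul.
elim: c => [a e1 e2|a e|c1 h1 c2 h2|e c h|i k c h]; [exact: pc..|exact: pa| |].
  exact: pa (pc (size (expr_code e 0) + 2)) h.
exact: pa (pm _ _ pi (pa _ _ h (pc 4))) (pc 4).
Qed.

Lemma small_constE P : exists K, all (small_const K) P.
Proof.
elim: P => [|I P [K cP]]; first by exists 0.
pose a := if I is IConst _ a then a else 0; exists (a + K) => /=; apply/andP; split.
  rewrite /a; case: I {a} => //= _ a; apply: leq_ltn_trans (leq_addr K a) _.
  exact: ltn_expl.
by apply: sub_all cP => -[] // i b /= /leq_trans; apply; rewrite leq_exp2l // leq_addl.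
Qed.

Definition header : program :=
  [:: IConst one 1; IRead (vreg 0); IRead (vreg 1); IRead (vreg 2); IRead (vreg 3);
      IRead (vreg 4); IAdd (vreg 5) (vreg 0) (vreg 4); IConst (vreg 6) 2].

Lemma header_block n e o i m rest : exists r,
  block header (fun=> 0) [:: n, e, o, i, m & rest] r rest /\
  agree (iota 0 7) (nth 0 [:: n; e; o; i; m; n + m; 2]) (fun _ _ => 0) r.
Proof.
pose u1 := upd (fun=> 0) one 1; pose u2 := upd u1 (vreg 0) n.
pose u3 := upd u2 (vreg 1) e; pose u4 := upd u3 (vreg 2) o.
pose u5 := upd u4 (vreg 3) i; pose u6 := upd u5 (vreg 4) m.
pose u7 := upd u6 (vreg 5) (n + m); exists (upd u7 (vreg 6) 2); split.
  move=> P pc /code_at_hd[c1 /code_at_hd[c2 /code_at_hd[c3 /code_at_hd[c4]]]].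
  move=> /code_at_hd[c5 /code_at_hd[c6 /code_at_hd[c7 /code_at_hd[c8 _]]]].
  rewrite /header /= addnC.
  apply: run_step c1 erefl _; apply: run_step c2 erefl _; apply: run_step c3 erefl _.
  apply: run_step c4 erefl _; apply: run_step c5 erefl _; apply: run_step c6 erefl _.
  by apply: run_step c7 erefl _; apply: run_step c8 erefl _; apply: run0.
have E a j : a < 13 -> upd u7 (vreg 6) 2 (areg a j) = 0.
  move=> lta; have ne k v (r : nat -> nat) : upd r (vreg k) v (areg a j) = r (areg a j).
    by rewrite /upd; case: eqP => // /areg_inj-[] //; lia.
  rewrite ne /u7 ne /u6 ne /u5 ne /u4 ne /u3 ne /u2 ne /u1 /upd.
  by case: (areg a j =P one) => // /areg_inj-[] //; lia.
split=> [a j lta|j||]; [by apply: E; lia| |reflexivity..].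
by rewrite !inE; do 6!(case/orP; first by move/eqP ->); move/eqP ->.
Qed.

(* The verdict is the emptiness of the cell 0 of the array [v]. *)
Definition compile (v : nat) (c : cmd) : program :=
  let p := header ++ code 8 c ++ expr_code (ELoad v (EConst 0)) 0 in
  p ++ [:: IJpos (tmp 0) (size p + 2); IHalt true; IHalt false].

(** All loop bounds are initial variables, hence at most [sz a + 2]; this bounds the number of
    instructions, and [run_halts] turns it into a cost. *)
Lemma poly_time_cmd (A : Type) (encode : A -> seq nat) (sz : A -> nat)
    (L : A -> Prop) (v : nat) (c : cmd) :
  v < 12 -> wf (iota 0 7) c ->
  (forall a, exists n e o i m rest,
    [/\ encode a = [:: n, e, o, i, m & rest], all (fun x => x <= sz a) (encode a),
        n + m <= sz a &
        (exec c (nth 0 [:: n; e; o; i; m; n + m; 2]) (fun _ _ => 0, rest)).1 v 0 = 0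
        <-> L a]) ->
  poly_time_decidable encode sz L.
Proof.
move=> ltv wfc spec; set P := compile v c.
(* [F] counts the 8 header instructions, the evaluation of the verdict and the jump on it. *)
have [K cP] := small_constE P; pose F := 8 + size (expr_code (ELoad v (EConst 0)) 0) + 1.
pose T s := F + time c (s + 2).
have [p hp] : poly_bounded (fun s => T s * (2 * (s + (K + 1 + T s))) + 1).
  have pc := poly_bounded_const; have pi := poly_bounded_id.
  have pa := poly_bounded_add; have pm := poly_bounded_mul.
  have pT : poly_bounded T by apply: pa (pc _) (poly_bounded_time _ (pa _ _ pi (pc 2))).
  exact: pa (pm _ _ pT (pm _ _ (pc 2) (pa _ _ pi (pa _ _ (pc _) pT)))) (pc 1).
exists P, p => a; have [n [e [o [i [m [rest [encE le_sz le_nm correct]]]]]]] := spec a.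
pose rho := nth 0 [:: n; e; o; i; m; n + m; 2].
have lerho x : x \in iota 0 7 -> rho x <= sz a + 2.
  move: le_sz; rewrite encE /rho /=; case/and5P=> ? ? ? ? /andP[? _].
  rewrite !inE; do 6!(case/orP; first by move/eqP => -> /=; lia).
  by move/eqP => -> /=; lia.
have [r0 [b0 ag0]] := header_block n e o i m rest.
case ex: (exec c rho (fun _ _ => 0, rest)) correct => [m1 w1] /= correct.
have atP : code_at P 0 P by move=> j; rewrite add0n.
have [/code_at_cat[at1 /code_at_cat[at2 at3]] at4] := code_at_cat atP.
have run1 := b0 _ _ at1.
have [k [r1 [lek run2 ag1]]] := code_run wfc lerho ag0 ex at2.
have [|r2 [b3 v3 _]] := @expr_code_block _ (ELoad v (EConst 0)) 0 _ _ _ w1 _ ag1.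
  by rewrite /= ltv.
have run3 := b3 _ _ at3; have run13 := run_trans run1 (run_trans run2 run3).
move: at4 => /code_at_hd[c1 /code_at_hd[c2 /code_at_hd[c3 _]]].
set q := size _ in c1 c2 c3; rewrite add0n in c1 c2 c3.
have qE : 0 + size header + size (code 8 c) + size (expr_code (ELoad v (EConst 0)) 0) = q.
  by rewrite /q !size_cat !addnA add0n.
rewrite -/rho in run13; move: run13; rewrite [pc in Config pc r2]qE => run13.
pose b := m1 v 0 == 0.
have [r3 run4] : exists r3, run P 1 (Config q r2 w1) (Config (if b then q.+1 else q.+2) r3 w1).
  exists r2; apply: run_step c1 _ (run0 _ _); rewrite /= v3 /= addn2 /b.
  by case: (m1 v 0).
have run_all := run_trans run13 run4.
have hlt : onth P (if b then q.+1 else q.+2) = Some (IHalt b) by rewrite /b; case: ifP.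
(* Width [K] suffices for the constants of the program, and [sz a] for the input, since a number is
   less than the power of two with itself as exponent. *)
have [||N hN leN] := run_halts (w := K + sz a) run_all hlt.
- apply: sub_all cP => -[] // j x /= /leq_trans; apply.
  by rewrite leq_exp2l // leq_addr.
- split=> [j|] /=; first by rewrite expn_gt0.
  have := le_sz; rewrite encE; apply: sub_all => x lex.
  apply: leq_ltn_trans (ltn_expl _ (isT : 1 < 2)).
  exact: leq_trans lex (leq_addl _ _).
exists b, N; split; last by rewrite -correct; split=> /eqP.
  by rewrite /start encE.
apply: leq_trans (hp _); apply: leq_trans leN _; rewrite leq_add2r.
set n1 := _ + 1; have leT : n1 <= T (sz a) by rewrite /n1 /T /F /=; lia.
by apply: leq_mul => //; rewrite leq_mul2l /=; lia.
Qed.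

(** * The decision program *)

Arguments exec : simpl never.

Local Notation mstate := (memory * seq nat)%type.

(** * Reasoning about bounded loops *)

Lemma exec_store a e1 e2 rho s : exec (CStore a e1 e2) rho s =
  (store s.1 a (eval rho s.1 e1) (eval rho s.1 e2), s.2).
Proof. by []. Qed.

Lemma exec_read a e rho s : exec (CRead a e) rho s =
  (store s.1 a (eval rho s.1 e) (head 0 s.2), behead s.2).
Proof. by []. Qed.

Lemma exec_seq c1 c2 rho s : exec (CSeq c1 c2) rho s = exec c2 rho (exec c1 rho s).
Proof. by []. Qed.

Lemma exec_if e c rho s :
  exec (CIf e c) rho s = if 0 < eval rho s.1 e then exec c rho s else s.
Proof. by []. Qed.

Lemma for_ind (I : nat -> mstate -> Prop) N i k c rho s : rho k = N -> I 0 s ->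
  (forall j s, j < N -> I j s -> I j.+1 (exec c (upd rho i j) s)) ->
  I N (exec (CFor i k c) rho s).
Proof.
move=> <- I0 IS; rewrite /exec -/exec.
have H l j s' : j + l = rho k -> I j s' ->
    I (rho k) (foldl (fun s j => exec c (upd rho i j) s) s' (iota j l)).
  elim: l j s' => [|l IH] j s' jl Ij /=; first by rewrite -jl addn0.
  by apply: IH; [lia | apply: IS => //; lia].
exact: H.
Qed.

Lemma for_inv (P : mstate -> Prop) i k c rho s : P s ->
  (forall j s, j < rho k -> P s -> P (exec c (upd rho i j) s)) ->
  P (exec (CFor i k c) rho s).
Proof. exact: (@for_ind (fun=> P) _ _ _ _ _ _ erefl). Qed.

(** Made for search loops: [P] lasts until the one iteration [j] that matters, which establishes
    [Q], and the later iterations keep [Q]. *)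
Lemma for_reach (P Q : mstate -> Prop) i k c rho s j : j < rho k -> P s ->
  (forall j s, j < rho k -> P s -> P (exec c (upd rho i j) s)) ->
  (forall j s, j < rho k -> Q s -> Q (exec c (upd rho i j) s)) ->
  (forall s, P s -> Q (exec c (upd rho i j) s)) ->
  Q (exec (CFor i k c) rho s).
Proof.
move=> ltj Ps PP QQ PQ.
suff [_] : P (exec (CFor i k c) rho s) /\ (j < rho k -> Q (exec (CFor i k c) rho s)).
  exact.
apply: (for_ind (I := fun l s => P s /\ (j < l -> Q s)) erefl) => // l s' ltl [Ps' Qs'].
split; first exact: PP; rewrite ltnS leq_eqVlt => /orP[/eqP <-|lt].
  exact: PQ.
by apply: QQ => //; apply: Qs'.
Qed.

Fixpoint writes (c : cmd) : seq nat :=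
  match c with
  | CStore a _ _ | CRead a _ => [:: a]
  | CSeq c1 c2 => writes c1 ++ writes c2
  | CIf _ c | CFor _ _ c => writes c
  end.

Lemma exec_frame c rho s a i : a \notin writes c -> (exec c rho s).1 a i = s.1 a i.
Proof.
elim: c rho s => [b e1 e2|b e|c1 IH1 c2 IH2|e c IH|v k c IH] rho s /=.
- by rewrite inE /store => /negbTE ->.
- by rewrite inE /store => /negbTE ->.
- by rewrite mem_cat negb_or exec_seq => /andP[n1 n2]; rewrite IH2 // IH1.
- by move=> na; rewrite exec_if; case: ifP => // _; apply: IH.
- move=> na; apply: (for_inv (P := fun s' => s'.1 a i = s.1 a i)) => // j s' _ <-.
  exact: IH.
Qed.

(** A syntactic check that an array representing a set by its positive cells can only grow. *)
Fixpoint only_sets (a : nat) (c : cmd) : bool :=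
  match c with
  | CStore b _ e => (a == b) ==> (if e is EConst n then 0 < n else false)
  | CRead b _ => a != b
  | CSeq c1 c2 => only_sets a c1 && only_sets a c2
  | CIf _ c | CFor _ _ c => only_sets a c
  end.

Lemma exec_mono a c rho s i : only_sets a c -> 0 < s.1 a i -> 0 < (exec c rho s).1 a i.
Proof.
elim: c rho s => [b e1 e2|b e|c1 IH1 c2 IH2|e c IH|v k c IH] rho s /=.
- rewrite /store; case: eqP => //= _; case: eqP => //= _.
  by case: e2.
- by rewrite /store => /negbTE ->.
- by rewrite exec_seq => /andP[o1 o2] h; apply: IH2 => //; apply: IH1.
- by move=> o h; rewrite exec_if; case: ifP => // _; apply: IH.
- by move=> o h; apply: (for_inv (P := fun s' => 0 < s'.1 a i)) => // j s' _ /IH; apply.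
Qed.

Lemma drop_onth T (s : seq T) j : j < size s ->
  exists2 x, onth s j = Some x & drop j s = x :: drop j.+1 s.
Proof. by elim: s j => [|x s IH] [|j] //=; [exists x; rewrite ?drop0|apply: IH]. Qed.

(* Arrays: 0 holds the initial states, 1 the labels of the events, 2 to 5 the
   sources, events, targets and labels of the moves, 6 the row offsets of the
   numbering of nodes, 7 and 8 sets of nodes, 9 the verdict.  Variables 0 to 6
   hold the numbers of states, events, outputs, initial states, transitions and
   moves, and the constant 2. *)
Definition read_code : cmd :=
  CSeq (CFor 7 3 (CRead 0 (EVar 7))) (CSeq (CFor 7 1 (CRead 1 (EVar 7)))
  (CFor 7 4 (CSeq (CRead 2 (EVar 7)) (CSeq (CRead 3 (EVar 7))
     (CSeq (CRead 4 (EVar 7))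
       (CStore 5 (EVar 7) (ELoad 1 (ELoad 3 (EVar 7))))))))).

(** The resting moves are appended after the transitions, in the order of [moves]; label 0 is the
    empty one. *)
Definition rest_code : cmd :=
  CFor 7 0 (CSeq (CStore 2 (EAdd (EVar 4) (EVar 7)) (EVar 7))
    (CSeq (CStore 4 (EAdd (EVar 4) (EVar 7)) (EVar 7))
          (CStore 5 (EAdd (EVar 4) (EVar 7)) (EConst 0)))).

(** Multiples of twice the number of states are tabulated by repeated addition, starting from a cell
    0 that is initially zero. *)
Definition offset_code : cmd :=
  CFor 7 0 (CStore 6 (EAdd (EVar 7) (EConst 1))
                     (EAdd (ELoad 6 (EVar 7)) (EAdd (EVar 0) (EVar 0)))).

Definition enode (x y f : expr) : expr := EAdd (EAdd (ELoad 6 x) (EAdd y y)) f.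

(** With truncated subtraction this is the absolute difference, which is positive exactly when the
    values differ. *)
Definition edist (x y : expr) : expr := EAdd (ESub x y) (ESub y x).

Definition enot (x : expr) : expr := ESub (EConst 1) x.

Definition relax_code a (u w : expr) : cmd := CIf (ELoad a u) (CStore a w (EConst 1)).

(** The double [enot] reduces the sum of the flag and the encoded label to 0 or 1, which is the
    disjunction required of the new flag. *)
Definition sync_code a : cmd :=
  CFor 10 5 (CFor 11 5 (CFor 12 6
    (CIf (enot (edist (ELoad 5 (EVar 10)) (ELoad 5 (EVar 11))))
      (relax_code a
        (enode (ELoad 2 (EVar 10)) (ELoad 2 (EVar 11)) (EVar 12))
        (enode (ELoad 4 (EVar 10)) (ELoad 4 (EVar 11))
               (enot (enot (EAdd (EVar 12) (ELoad 5 (EVar 10)))))))))).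

Definition reset_code a : cmd :=
  CFor 10 0 (CFor 11 0 (CFor 12 6
    (relax_code a (enode (EVar 10) (EVar 11) (EVar 12))
                  (enode (EVar 10) (EVar 10) (EVar 12))))).

Definition round_code a : cmd := CSeq (sync_code a) (reset_code a).

(** The three counters only make the number of rounds equal to the number of nodes, after which the
    closure is complete. *)
Definition closure_code a : cmd :=
  CFor 13 0 (CFor 14 0 (CFor 15 6 (round_code a))).

Definition init_code : cmd :=
  CFor 7 3 (CFor 8 3
    (CStore 7 (enode (ELoad 0 (EVar 7)) (ELoad 0 (EVar 8)) (EConst 1)) (EConst 1))).

(** The cell of every node is overwritten, which also erases the closure computed for the previous
    pair. *)
Definition start_code : cmd :=
  CFor 10 0 (CFor 11 0 (CFor 12 6
    (CStore 8 (enode (EVar 10) (EVar 11) (EVar 12))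
       (enot (edist (enode (EVar 10) (EVar 11) (EVar 12))
                    (enode (EVar 7) (EVar 8) (EConst 0))))))).

Definition verdict_code : cmd :=
  CIf (edist (EVar 7) (EVar 8)) (CIf (ELoad 7 (enode (EVar 7) (EVar 8) (EConst 1)))
    (CIf (ELoad 8 (enode (EVar 7) (EVar 8) (EConst 1)))
       (CStore 9 (EConst 0) (EConst 1)))).

Definition check_code : cmd :=
  CFor 7 0 (CFor 8 0 (CSeq start_code (CSeq (closure_code 8) verdict_code))).

Definition prog : cmd :=
  CSeq read_code (CSeq rest_code (CSeq offset_code
    (CSeq init_code (CSeq (closure_code 7) check_code)))).

(** * Numbering of the nodes and contents of the tables *)

Section Correctness.
Variable S : automaton.
Local Notation n := #|state S|.
Local Notation m := #|transition S|.
Local Notation node := (state S * state S * bool)%type.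
Implicit Types (u v w : node) (s : mstate).

Definition idx v : nat := enum_rank v.1.1 * (n + n) + (enum_rank v.1.2 + enum_rank v.1.2) + v.2.

(** This is a mixed-radix numbering: the second state and the flag contribute less than [n + n], so
    division recovers the first state, and parity then separates the flag. *)
Lemma idx_inj : injective idx.
Proof.
move=> [[x y] f] [[x' y'] f']; rewrite /idx /=.
have := ltn_ord (enum_rank y); have := ltn_ord (enum_rank y').
move: (@enum_rank_inj _ x x') (@enum_rank_inj _ y y') => injx injy.
move: (enum_rank x) (enum_rank x') (enum_rank y) (enum_rank y') injx injy.
move: #|state S| => N a a' b b' injx injy lt' lt e.
have k1 : b + b + f < N + N by case: (f) => /=; lia.
have k2 : b' + b' + f' < N + N by case: (f') => /=; lia.
have ea : a = a' :> nat.
  have := congr1 (fun k => k %/ (N + N)) e.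
  rewrite -!addnA !divnMDl ?(leq_ltn_trans _ k1) // !addnA.
  by rewrite (divn_small k1) (divn_small k2) !addn0.
have eb : b + b + f = b' + b' + f' by move: e; rewrite ea; lia.
have [{}eb ef] : b = b' :> nat /\ f = f' by move: eb; case: (f); case: (f') => /=; lia.
by rewrite ef (injx (val_inj ea)) (injy (val_inj eb)).
Qed.

Definition params (rho : nat -> nat) := [/\ rho 0 = n, rho 3 = #|initial S|, rho 4 = m,
  rho 5 = n + m & rho 6 = 2].

Definition tables (M : memory) :=
  (forall t tr, onth (moves S) t = Some tr -> [/\ M 2 t = enum_rank tr.1.1,
     M 4 t = enum_rank tr.2 & M 5 t = encode_label tr.1.2]) /\
  (forall i, i < n -> M 6 i = i * (n + n)).

Definition has (M : memory) a v : bool := 0 < M a (idx v).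

Lemma tables_exec c rho s : all (fun a => a \notin writes c) [:: 2; 4; 5; 6] ->
  tables s.1 -> tables (exec c rho s).1.
Proof.
case/and5P=> n2 n4 n5 n6 _ [tm tA]; split=> [t tr ot|i lti].
  by rewrite !exec_frame //; apply: tm.
by rewrite exec_frame //; apply: tA.
Qed.

Lemma eval_enode rho M ex ey ef x y (f : bool) : tables M ->
  eval rho M ex = enum_rank x -> eval rho M ey = enum_rank y -> eval rho M ef = f ->
  eval rho M (enode ex ey ef) = idx (x, y, f).
Proof. by move=> [_ tA] /= -> -> ->; rewrite tA. Qed.

Lemma encode_label_inj : injective (@encode_label S).
Proof.
case=> [a|] [b|] //= [] e; congr Some; apply: enum_rank_inj; exact: val_inj.
Qed.

Lemma has_store M a (e : nat) u v : has (store M a (idx u) e) a v =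
  if v == u then 0 < e else has M a v.
Proof.
by rewrite /has /store eqxx (inj_eq idx_inj); case: eqP.
Qed.

Lemma relaxE a rho s eu ew u w v : eval rho s.1 eu = idx u -> eval rho s.1 ew = idx w ->
  has (exec (relax_code a eu ew) rho s).1 a v = has s.1 a v || has s.1 a u && (v == w).
Proof.
move=> euE ewE; rewrite /relax_code exec_if /= euE -/(has s.1 a u).
case: ifP => [hu|_]; last by rewrite orbF.
by rewrite exec_store /= ewE has_store /=; case: eqP => _; rewrite ?orbT ?orbF.
Qed.

Lemma stateP i : i < n -> exists x : state S, i = enum_rank x.
Proof. by move=> lt; exists (enum_val (Ordinal lt)); rewrite enum_valK. Qed.

Lemma boolP2 i : i < 2 -> exists f : bool, i = f.
Proof. by case: i => [|[|//]] _; [exists false|exists true]. Qed.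

Lemma size_moves : size (moves S) = n + m.
Proof. by rewrite size_cat !size_map addnC !cardE enumT. Qed.

Lemma moveP t : t < n + m -> exists tr, onth (moves S) t = Some tr.
Proof. by rewrite -size_moves => /drop_onth[tr ot _]; exists tr. Qed.

Lemma params_upd rho i j : params rho -> 6 < i -> params (upd rho i j).
Proof.
move=> [p0 p3 p4 p5 p6] lti; have E k : k <= 6 -> upd rho i j k = rho k.
  by rewrite /upd; case: eqP => // ->; rewrite leqNgt lti.
by split; rewrite E.
Qed.

Lemma enot_dist l l' : (0 < 1 - (l - l' + (l' - l))) = (l == l').
Proof. lia. Qed.

Lemma flagE (f : bool) o :
  1 - (1 - (f + @encode_label S o)) = (f || isSome o) :> nat.
Proof. by case: f; case: o => //= x; lia. Qed.

Lemma edist_pos a b : (0 < a - b + (b - a)) = (a != b).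
Proof. lia. Qed.

(** * Closure of a set of nodes under edges *)

Section Closure.
Variable a : nat.
Hypothesis a_set : a \notin [:: 2; 4; 5; 6].

Lemma tables_only c rho s : writes c = [:: a] -> tables s.1 -> tables (exec c rho s).1.
Proof.
move=> wc; apply: tables_exec; apply/allP => b bset; rewrite wc mem_seq1.
by apply: contraNneq a_set => <-.
Qed.

(** [Z] bounds the marked set from above, and is used with sets closed under edges; the tables are
    included because node numbers are computed from them. *)
Definition sound (Z : node -> Prop) s := tables s.1 /\ forall v, has s.1 a v -> Z v.

Lemma relax_sound (Z : node -> Prop) rho s eu ew u w : eval rho s.1 eu = idx u ->
  eval rho s.1 ew = idx w -> (Z u -> Z w) -> sound Z s ->
  sound Z (exec (relax_code a eu ew) rho s).
Proof.
move=> euE ewE uw [tab hZ]; split; first exact: tables_only.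
by move=> v; rewrite (relaxE _ _ euE ewE) => /orP[/hZ //|/andP[/hZ/uw zw /eqP ->]].
Qed.

Lemma sync_sound (Z : node -> Prop) rho s : params rho ->
  (forall u v, pair_edge u v -> Z u -> Z v) ->
  sound Z s -> sound Z (exec (sync_code a) rho s).
Proof.
move=> [_ _ _ p5 p6] cl sZ; apply: for_inv => // t1 s1; rewrite p5 => lt1 {}sZ.
apply: for_inv => // t2 s2; rewrite [upd _ _ _ _]p5 => lt2 {}sZ.
apply: for_inv => // f s3; rewrite [upd _ _ _ _]p6 => /boolP2[b ->] {}sZ {f}.
have [[[x o] x'] o1] := moveP lt1; have [[[y o'] y'] o2] := moveP lt2.
have tab := sZ.1; have [/= S1 D1 L1] := tab.1 _ _ o1; have [/= S2 D2 L2] := tab.1 _ _ o2.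
rewrite exec_if; case: ifP => //; rewrite /= enot_dist L1 L2.
rewrite (inj_eq encode_label_inj) => /eqP oo.
apply: (@relax_sound Z _ _ _ _ (x, y, b) (x', y', b || isSome o)) => //.
- exact: eval_enode.
- by apply: eval_enode; rewrite //= L1 flagE.
- apply: cl; apply/orP; left; apply/existsP; exists o.
  by rewrite /= (introT onthP (ex_intro _ _ o1)) oo (introT onthP (ex_intro _ _ o2)) /=.
Qed.

Lemma reset_sound (Z : node -> Prop) rho s : params rho ->
  (forall u v, pair_edge u v -> Z u -> Z v) ->
  sound Z s -> sound Z (exec (reset_code a) rho s).
Proof.
move=> [p0 _ _ _ p6] cl sZ; apply: for_inv => // t1 s1; rewrite p0 => /stateP[x ->] {}sZ.
apply: for_inv => // t2 s2; rewrite [upd _ _ _ _]p0 => /stateP[y ->] {}sZ.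
apply: for_inv => // f s3; rewrite [upd _ _ _ _]p6 => /boolP2[b ->] {}sZ {f}.
have tab := sZ.1; apply: (@relax_sound Z _ _ _ _ (x, y, b) (x, x, b)) => //.
- exact: eval_enode.
- exact: eval_enode.
- by apply: cl; rewrite /pair_edge /= eqxx orbT.
Qed.

Definition holds u s := tables s.1 /\ has s.1 a u.

Lemma holds_exec u c rho s : writes c = [:: a] -> only_sets a c -> holds u s ->
  holds u (exec c rho s).
Proof. by move=> wc oc [tab hu]; split; [exact: tables_only | exact: exec_mono]. Qed.

Lemma relax_holds rho s eu ew u w : eval rho s.1 eu = idx u ->
  eval rho s.1 ew = idx w -> holds u s -> holds w (exec (relax_code a eu ew) rho s).
Proof.
move=> euE ewE [tab hu]; split; first exact: tables_only.
by rewrite (relaxE _ _ euE ewE) hu eqxx orbT.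
Qed.

(** Each loop is followed to the iteration matching the edge: the indices of its two moves, or the
    pair being reset. All other iterations keep existing marks, because the set only grows. *)
Lemma round_complete rho s u w : params rho -> pair_edge u w -> holds u s ->
  holds w (exec (round_code a) rho s).
Proof.
move=> [p0 _ _ p5 p6] uw hu; rewrite /round_code exec_seq.
have wo : only_sets a (sync_code a) /\ only_sets a (reset_code a) by rewrite /= implybT.
have keep v c rho' s' : writes c = [:: a] -> only_sets a c -> holds v s' ->
  holds v (exec c rho' s') by apply: holds_exec.
case: u w uw hu => [[x y] b] [[x' y'] b'].
case/orP => [/existsP[o /and3P[/= m1 m2 /eqP ->]]|/eqP[-> -> ->]] hu.
  have [t1 o1] := onthP m1; have [t2 o2] := onthP m2.
  have lt1 : t1 < n + m by rewrite -size_moves -onthTE o1.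
  have lt2 : t2 < n + m by rewrite -size_moves -onthTE o2.
  apply: (keep) => //; first exact: wo.2.
  apply: (for_reach (P := holds (x, y, b)) (j := t1)) => //; first by rewrite p5.
  - by move=> j s' _; apply: (keep) => //=; rewrite implybT.
  - by move=> j s' _; apply: (keep) => //=; rewrite implybT.
  move=> {hu}s1 hu; apply: (for_reach (P := holds (x, y, b)) (j := t2)) => //.
  - by rewrite [upd _ _ _ _]p5.
  - by move=> j s' _; apply: (keep) => //=; rewrite implybT.
  - by move=> j s' _; apply: (keep) => //=; rewrite implybT.
  move=> {hu}s2 hu; apply: (for_reach (P := holds (x, y, b)) (j := b)) => //.
  - by rewrite [upd _ _ _ _]p6; case: (b).
  - by move=> j s' _; apply: (keep) => //=; rewrite implybT.
  - by move=> j s' _; apply: (keep) => //=; rewrite implybT.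
  move=> {hu}s3 hu; have tab := hu.1.
  have [/= S1 D1 L1] := tab.1 _ _ o1; have [/= S2 D2 L2] := tab.1 _ _ o2.
  rewrite exec_if /= enot_dist L1 L2 eqxx; apply: relax_holds hu.
    exact: eval_enode.
  by apply: eval_enode; rewrite //= L1 flagE.
have {}hu : holds (x, y, b) (exec (sync_code a) rho s) by apply: keep wo.1 hu.
apply: (for_reach (P := holds (x, y, b)) (j := enum_rank x)) => //; first by rewrite p0.
- by move=> j s' _; apply: (keep) => //=; rewrite implybT.
- by move=> j s' _; apply: (keep) => //=; rewrite implybT.
move=> {hu}s1 hu; apply: (for_reach (P := holds (x, y, b)) (j := enum_rank y)) => //.
- by rewrite [upd _ _ _ _]p0.
- by move=> j s' _; apply: (keep) => //=; rewrite implybT.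
- by move=> j s' _; apply: (keep) => //=; rewrite implybT.
move=> {hu}s2 hu; apply: (for_reach (P := holds (x, y, b)) (j := b)) => //.
- by rewrite [upd _ _ _ _]p6; case: (b).
- by move=> j s' _; apply: (keep) => //=; rewrite implybT.
- by move=> j s' _; apply: (keep) => //=; rewrite implybT.
by move=> {hu}s3 hu; have tab := hu.1; apply: relax_holds hu; apply: eval_enode.
Qed.

Lemma round_sound (Z : node -> Prop) rho s : params rho ->
  (forall u v, pair_edge u v -> Z u -> Z v) ->
  sound Z s -> sound Z (exec (round_code a) rho s).
Proof.
by move=> pr cl sZ; rewrite exec_seq; apply: reset_sound => //; apply: sync_sound.
Qed.

Lemma closure_spec rho s : params rho -> tables s.1 ->
  tables (exec (closure_code a) rho s).1 /\
  forall v, has (exec (closure_code a) rho s).1 a v <->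
    exists2 u, has s.1 a u & connect (@pair_edge S) u v.
Proof.
move=> pr tab; have [p0 _ _ _ p6] := pr.
pose Z v := exists2 u, has s.1 a u & connect (@pair_edge S) u v.
have cl u v : pair_edge u v -> Z u -> Z v.
  by move=> uv [x hx xu]; exists x => //; apply: connect_trans xu (connect1 uv).
(* The reachable set is the least fixpoint of [F], which adds the successors of [X] to the starting
   set. *)
pose F (X : {set node}) := [set v | has s.1 a v] :|:
  [set v | [exists u in X, pair_edge u v]].
have monoF : {homo F : X Y / X \subset Y}.
  move=> X Y sXY; apply: setUS; apply/subsetP => v; rewrite !inE.
  by case/existsP => u /andP[uX uv]; apply/existsP; exists u; rewrite (subsetP sXY).
(* After [k] rounds the marked set lies between the [k]-th iterate of [F] and the reachable set.
   Marks made early within a round may already carry it beyond that iterate. *)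
pose I k s' := [/\ sound Z s', forall v, has s.1 a v -> has s'.1 a v
  & forall v, v \in iter k F set0 -> has s'.1 a v].
have IS k rho' s' : params rho' -> I k s' -> I k.+1 (exec (round_code a) rho' s').
  move=> pr' [sZ base it]; split; first exact: round_sound.
  - by move=> v /base; apply: exec_mono; rewrite /= implybT.
  move=> v; rewrite iterS !inE => /orP[/base|/existsP[u /andP[/it hu uv]]].
    by apply: exec_mono; rewrite /= implybT.
  by have [] := round_complete pr' uv (conj sZ.1 hu).
have : I (n * (n * 2)) (exec (closure_code a) rho s).
  apply: (for_ind (I := fun j => I (j * (n * 2))) p0) => [|j1 s1 _ I1].
    split=> [|//|v]; last by rewrite inE.
    by split=> // v hv; exists v.
  rewrite mulSnr; apply: (for_ind (I := fun j => I (j1 * (n * 2) + j * 2)) p0).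
    by rewrite addn0.
  move=> j2 s2 _ I2; rewrite mulSnr addnA.
  apply: (for_ind (I := fun j => I (j1 * (n * 2) + j2 * 2 + j)) p6).
    by rewrite addn0.
  by move=> j3 s3 _ I3; rewrite addnS; apply: IS => //; do 3!apply: params_upd.
case=> [[tab' hZ] base it]; split=> // v; split; first exact: hZ.
case=> u hu uv; pose C := fixset F.
(* [fixset] iterates as many times as there are nodes, which is exactly the number of rounds. *)
have CE : iter (n * (n * 2)) F set0 = C by rewrite /C /fixset !card_prod card_bool mulnA.
apply: it; rewrite CE; have CK : F C = C by apply: fixsetK.
have uC : u \in C by rewrite -CK !inE hu.
case/connectP: uv => p; elim: p u uC {hu} => [|w p IH] u uC /= => [_ -> //|/andP[uw wp]].
apply: IH => //; rewrite -CK !inE; apply/orP; right.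
by apply/existsP; exists u; rewrite uC.
Qed.

End Closure.

(** * Filling the tables and the initial sets of nodes *)

Definition same (i : nat) (M M' : memory) := forall j, M' i j = M i j.

Lemma read_array a k rho s (l w : seq nat) : rho k = size l -> s.2 = l ++ w ->
  (exec (CFor 7 k (CRead a (EVar 7))) rho s).2 = w /\
  forall i, i < size l -> (exec (CFor 7 k (CRead a (EVar 7))) rho s).1 a i = nth 0 l i.
Proof.
move=> rk tp.
have [] := for_ind (I := fun j s => s.2 = drop j l ++ w /\
  forall i, i < j -> s.1 a i = nth 0 l i) (c := CRead a (EVar 7)) (i := 7) (s := s) rk.
- by rewrite drop0.
- move=> j s1 ltj [t1 m1]; rewrite exec_read /= t1 (drop_nth 0 ltj) /=.
  split=> // i; rewrite ltnS leq_eqVlt /store eqxx /=.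
  by case: eqP => [-> //|_]; apply: m1.
- by rewrite drop_size.
Qed.

Lemma read_spec rho M : params rho -> rho 1 = #|event S| ->
  let s := exec read_code rho (M, [seq (enum_rank x : nat) | x <- enum (initial S)]
    ++ [seq encode_label (label e) | e <- enum (event S)]
    ++ flatten [seq encode_transition tr | tr <- enum (transition S)]) in
  (forall i, i < #|initial S| ->
     s.1 0 i = nth 0 [seq (enum_rank x : nat) | x <- enum (initial S)] i) /\
  (forall t tr, onth (enum (transition S)) t = Some tr ->
    [/\ s.1 2 t = enum_rank tr.1.1, s.1 4 t = enum_rank tr.2
      & s.1 5 t = encode_label (label tr.1.2)]).
Proof.
move=> [_ p3 p4 _ _] p1; set l0 := map _ _; set l1 := map _ _; set l2 := map _ _.
have s0 : size l0 = #|initial S| by rewrite size_map -cardE.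
have s1 : size l1 = #|event S| by rewrite size_map cardE enumT.
rewrite /read_code !exec_seq; set S0 := (M, _).
have [t1 a1] := @read_array 0 3 rho S0 l0 _ (etrans p3 (esym s0)) erefl.
set S1 := exec _ rho S0 in t1 a1 *.
have [t2 a2] := @read_array 1 1 rho S1 l1 _ (etrans p1 (esym s1)) t1.
set S2 := exec _ rho S1 in t2 a2 *; set c := CSeq (CRead 2 _) _.
have lab (e : event S) : S2.1 1 (enum_rank e) = encode_label (label e).
  have lte : enum_rank e < size (enum (event S)) by rewrite -cardT.
  rewrite a2 /l1; first by rewrite (nth_map e 0) // nth_enum_rank.
  by rewrite size_map.
split=> [i lti|].
  by rewrite exec_frame // /S2 exec_frame // a1 ?s0.
have [] // := for_ind (I := fun j s => [/\ s.2 = flatten (drop j l2), same 1 S2.1 s.1 &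
  forall t tr, t < j -> onth (enum (transition S)) t = Some tr ->
    [/\ s.1 2 t = enum_rank tr.1.1, s.1 4 t = enum_rank tr.2
      & s.1 5 t = encode_label (label tr.1.2)]]) (c := c) (i := 7) (s := S2) p4.
- by rewrite drop0.
- move=> j s3 ltj [t3 e3 m3].
  have [|tr otr dtr] := @drop_onth _ (enum (transition S)) j; first by rewrite -cardE.
  rewrite /l2 -map_drop dtr in t3.
  rewrite /c !exec_seq !exec_read exec_store /= t3 /=.
  split=> // [|t tr']; first by rewrite map_drop.
  rewrite ltnS leq_eqVlt /store /=; case: eqP => [-> _|_ /= ltt ot]; last exact: m3.
  by rewrite otr !eqxx /= => -[<-]; rewrite e3 lab.
move=> _ _ h t tr ot; apply: h => //.
by rewrite cardE -onthTE ot.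
Qed.

Lemma rest_spec rho s : params rho ->
  (forall t tr, onth (enum (transition S)) t = Some tr ->
    [/\ s.1 2 t = enum_rank tr.1.1, s.1 4 t = enum_rank tr.2
      & s.1 5 t = encode_label (label tr.1.2)]) ->
  forall t tr, onth (moves S) t = Some tr ->
    [/\ (exec rest_code rho s).1 2 t = enum_rank tr.1.1,
        (exec rest_code rho s).1 4 t = enum_rank tr.2
      & (exec rest_code rho s).1 5 t = encode_label tr.1.2].
Proof.
move=> [p0 _ p4 _ _] tm.
have : (forall i t, t < m -> (exec rest_code rho s).1 i t = s.1 i t) /\
    (forall t, t < n -> [/\ (exec rest_code rho s).1 2 (m + t) = t,
      (exec rest_code rho s).1 4 (m + t) = t & (exec rest_code rho s).1 5 (m + t) = 0]).
  apply: (for_ind (I := fun j s' => (forall i t, t < m -> s'.1 i t = s.1 i t) /\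
    (forall t, t < j ->
       [/\ s'.1 2 (m + t) = t, s'.1 4 (m + t) = t & s'.1 5 (m + t) = 0])) p0) => //.
  move=> j s1 ltj [low high]; rewrite !exec_seq !exec_store /= [upd _ _ _ 4]p4 /=.
  rewrite /upd /= /store /=; split=> [i t ltt|t].
    by rewrite (ltn_eqF (ltn_addr j ltt)) !andbF low.
  rewrite ltnS leq_eqVlt eqn_add2l; case: eqP => [-> //|_ /= /high //].
case=> low high t tr; rewrite /moves onth_cat size_map -cardE.
case: ltnP => [ltt|le]; rewrite onth_map.
  case ot: onth => [tr'|] //= -[<-] /=; rewrite !low //; exact: tm.
case ot: onth => [x|] //= -[<-] /=.
have ltn : t - m < n by rewrite [X in _ < X]cardE -onthTE ot.
have tE : t - m = enum_rank x.
  have lt : t - m < size (enum (state S)) by rewrite -onthTE ot.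
  apply/eqP; rewrite -(nth_uniq x lt _ (enum_uniq _)) -?cardE //.
  by rewrite nth_enum_rank (onth_nth _ _ _ _ ot).
by have [] := high _ ltn; rewrite subnKC // tE.
Qed.

Lemma offset_spec rho s : params rho -> s.1 6 0 = 0 ->
  forall i, i < n -> (exec offset_code rho s).1 6 i = i * (n + n).
Proof.
move=> [p0 _ _ _ _] A0 i lti.
suff : forall i, i <= n -> (exec offset_code rho s).1 6 i = i * (n + n) by apply; exact: ltnW.
apply: (for_ind (I := fun j s' => forall i, i <= j -> s'.1 6 i = i * (n + n)) p0).
  by case.
move=> j s1 _ H {lti}i; rewrite exec_store /= /upd /= p0 /store /= addn1.
rewrite leq_eqVlt; case: eqP => [->|_] /=; last exact: H.
by rewrite H // mulSnr.
Qed.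

Definition initial_nodes (v : node) :=
  exists x y, [/\ x \in initial S, y \in initial S & v = (x, y, true)].

Lemma init_spec rho s : params rho -> tables s.1 ->
  (forall i, i < #|initial S| ->
     s.1 0 i = nth 0 [seq (enum_rank x : nat) | x <- enum (initial S)] i) ->
  (forall i, s.1 7 i = 0) ->
  forall v, has (exec init_code rho s).1 7 v <-> initial_nodes v.
Proof.
move=> pr tab ini zero7 v; have [_ p3 _ _ _] := pr.
have iniP i : i < #|initial S| -> exists2 x, x \in initial S & s.1 0 i = enum_rank x.
  move=> lti; rewrite ini //; have : i < size (enum (initial S)) by rewrite -cardE.
  case/drop_onth => x ox _; exists x; first by rewrite -mem_enum; apply/onthP; exists i.
  by rewrite (nth_map x) -?cardE // (onth_nth _ _ _ _ ox).
have iniK x : x \in initial S -> exists2 i, i < #|initial S| & s.1 0 i = enum_rank x.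
  rewrite -mem_enum => /onthP[i oi]; exists i; first by rewrite cardE -onthTE oi.
  rewrite ini ?cardE -?onthTE ?oi // (nth_map x) -?onthTE ?oi //.
  by rewrite (onth_nth _ _ _ _ oi).
have same0 c rho' s' : writes c = [:: 7] -> same 0 s.1 s'.1 ->
  same 0 s.1 (exec c rho' s').1 by move=> wc e j; rewrite exec_frame // wc.
have evN rho' (M : memory) x y : tables M -> M 0 (rho' 7) = enum_rank x ->
    M 0 (rho' 8) = enum_rank y ->
    eval rho' M (enode (ELoad 0 (EVar 7)) (ELoad 0 (EVar 8)) (EConst 1)) = idx (x, y, true).
  by move=> *; apply: eval_enode.
have tab7 c rho' s' : writes c = [:: 7] -> tables s'.1 -> tables (exec c rho' s').1.
  exact: tables_only.
split=> [|[x [y [ix iy ->]]]].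
  pose I s' := [/\ tables s'.1, same 0 s.1 s'.1 & forall v, has s'.1 7 v -> initial_nodes v].
  suff [_ _] : I (exec init_code rho s) by apply.
  apply: for_inv => [|i s1 lti I1]; first by split=> // w; rewrite /has zero7.
  apply: for_inv => // j s2; rewrite [upd _ _ _ 3]p3 => ltj [t2 e2 h2].
  have [x ix ex] : exists2 x, x \in initial S & s.1 0 i = enum_rank x.
    by apply: iniP; rewrite -p3.
  have [y iy ey] := iniP _ ltj.
  split; [exact: tab7|exact: same0|move=> w].
  rewrite exec_store (evN _ _ x y) ?e2 //= has_store.
  by case: eqP => [-> _|_ /h2 //]; exists x, y.
have [i lti ei] := iniK x ix; have [j ltj ej] := iniK y iy.
pose P s' := tables s'.1 /\ same 0 s.1 s'.1.
have Ps : P s by [].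
apply: (for_reach (P := P) (Q := fun s' => has s'.1 7 (x, y, true)) (j := i)) => //.
- by rewrite p3.
- by move=> j' s' _ [tab' e']; split; [exact: tab7|exact: same0].
- by move=> j' s' _; apply: exec_mono.
move=> s1 P1.
apply: (for_reach (P := P) (Q := fun s' => has s'.1 7 (x, y, true)) (j := j)) => //.
- by rewrite [upd _ _ _ 3]p3.
- by move=> j' s' _ h; apply: exec_mono h.
by move=> s2 [t2 e2]; rewrite exec_store (evN _ _ x y) ?e2 //= has_store eqxx.
Qed.

Lemma start_spec rho s x y : params rho -> tables s.1 -> rho 7 = enum_rank x ->
  rho 8 = enum_rank y ->
  forall v, has (exec start_code rho s).1 8 v = (v == (x, y, false)).
Proof.
move=> [p0 _ _ _ p6] tab r7 r8 v.
have tab8 c rho' s' : writes c = [:: 8] -> tables s'.1 -> tables (exec c rho' s').1.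
  exact: tables_only.
case: v => [[x1 y1] b1]; set v := (x1, y1, b1).
pose P s' := tables s'.1; pose Q s' := P s' /\ has s'.1 8 v = (v == (x, y, false)).
suff [_] : Q (exec start_code rho s) by [].
have body (rho' : nat -> nat) s' (x' y' : state S) (b' : bool) : P s' -> rho' 7 = enum_rank x ->
    rho' 8 = enum_rank y -> rho' 10 = enum_rank x' -> rho' 11 = enum_rank y' -> rho' 12 = b' ->
    has (exec (CStore 8 (enode (EVar 10) (EVar 11) (EVar 12))
       (enot (edist (enode (EVar 10) (EVar 11) (EVar 12))
                    (enode (EVar 7) (EVar 8) (EConst 0))))) rho' s').1 8 v =
    if v == (x', y', b') then v == (x, y, false) else has s'.1 8 v.
  move=> tab' e7 e8 e10 e11 e12; rewrite exec_store.
  have e1 : eval rho' s'.1 (enode (EVar 10) (EVar 11) (EVar 12)) = idx (x', y', b').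
    exact: eval_enode.
  have e0 : eval rho' s'.1 (enode (EVar 7) (EVar 8) (EConst 0)) = idx (x, y, false).
    by apply: (@eval_enode _ _ _ _ _ _ _ false).
  have evalD e e' : eval rho' s'.1 (enot (edist e e')) = 1 -
    (eval rho' s'.1 e - eval rho' s'.1 e' + (eval rho' s'.1 e' - eval rho' s'.1 e)) by [].
  rewrite evalD e1 e0 has_store enot_dist (inj_eq idx_inj).
  by case: (v =P (x', y', b')) => // ->.
have QQ i j f s' : i < n -> j < n -> f < 2 -> Q s' ->
    Q (exec (CStore 8 (enode (EVar 10) (EVar 11) (EVar 12))
       (enot (edist (enode (EVar 10) (EVar 11) (EVar 12))
                    (enode (EVar 7) (EVar 8) (EConst 0)))))
          (upd (upd (upd rho 10 i) 11 j) 12 f) s').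
  move=> /stateP[x' ->] /stateP[y' ->] /boolP2[b' ->] [tab' qv]; split; first exact: tab8.
  by rewrite (body _ _ x' y' b') //; case: ifP.
apply: (for_reach (P := P) (j := enum_rank x1)) => //; first by rewrite p0.
- by move=> j' s' _; apply: tab8.
- move=> i s1; rewrite p0 => lti Q1; apply: for_inv => // j s2; rewrite [upd _ _ _ 0]p0.
  move=> ltj Q2; apply: for_inv => // f s3; rewrite [upd _ _ _ 6]p6 => ltf.
  exact: QQ.
move=> s1 P1; apply: (for_reach (P := P) (j := enum_rank y1)) => //.
- by rewrite [upd _ _ _ 0]p0.
- by move=> j' s' _; apply: tab8.
- move=> j s2; rewrite [upd _ _ _ 0]p0 => ltj Q2.
  apply: for_inv => // f s3; rewrite [upd _ _ _ 6]p6 => ltf; exact: QQ.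
move=> s2 P2; apply: (for_reach (P := P) (j := b1)) => //.
- by rewrite [upd _ _ _ 6]p6; case: (b1).
- by move=> f s3; rewrite [upd _ _ _ 6]p6 => ltf; exact: QQ.
move=> s3 P3; split; first exact: tab8.
by rewrite (body _ _ x1 y1 b1) // eqxx.
Qed.

(** * The test over all pairs of states *)

Definition bad x y := [/\ x != y,
  exists2 u, initial_nodes u & connect (@pair_edge S) u (x, y, true) &
  connect (@pair_edge S) (x, y, false) (x, y, true)].

Definition reached (M : memory) := forall v, has M 7 v <->
  exists2 u, initial_nodes u & connect (@pair_edge S) u v.

Lemma body_spec rho s x y : params rho -> tables s.1 -> reached s.1 ->
  rho 7 = enum_rank x -> rho 8 = enum_rank y ->
  let s' := exec (CSeq start_code (CSeq (closure_code 8) verdict_code)) rho s in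
  [/\ tables s'.1, reached s'.1 & 0 < s'.1 9 0 <-> 0 < s.1 9 0 \/ bad x y].
Proof.
move=> pr tab rch r7 r8; rewrite !exec_seq; set s1 := exec start_code rho s.
have t1 : tables s1.1 by apply: tables_exec tab.
have h1 : forall v, has s1.1 8 v = (v == (x, y, false)) by exact: start_spec.
have [t2 h2] := @closure_spec 8 isT rho s1 pr t1; set s2 := exec _ rho s1 in t2 h2 *.
have rch2 : reached s2.1 by move=> v; rewrite /has /s2 /s1 !exec_frame //; apply: rch.
have b2 : s2.1 9 0 = s.1 9 0 by rewrite /s2 /s1 !exec_frame.
split; first exact: tables_exec.
  by move=> v; rewrite /has exec_frame //; apply: rch2.
have h2xy : has s2.1 8 (x, y, true) <-> connect (@pair_edge S) (x, y, false) (x, y, true).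
  apply: (iff_trans (h2 _)); split=> [[u]|c]; first by rewrite h1 => /eqP ->.
  by exists (x, y, false); rewrite // h1.
have ev : eval rho s2.1 (enode (EVar 7) (EVar 8) (EConst 1)) = idx (x, y, true).
  by apply: (@eval_enode _ _ _ _ _ _ _ true).
have evL a : eval rho s2.1 (ELoad a (enode (EVar 7) (EVar 8) (EConst 1))) =
  s2.1 a (idx (x, y, true)) by rewrite -ev.
rewrite /verdict_code exec_if [eval _ _ _]/= r7 r8 edist_pos -b2.
have -> : (enum_rank x != enum_rank y :> nat) = (x != y).
  by rewrite (inj_eq val_inj) (inj_eq enum_rank_inj).
case: ifP => [xy|xy]; last by split=> [|[//|[]]]; [left | rewrite xy].
rewrite exec_if evL -/(has s2.1 7 (x, y, true)); case: ifP => [r|r]; last first.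
  by split=> [|[//|[_ /rch2]]]; [left | rewrite r].
rewrite exec_if evL -/(has s2.1 8 (x, y, true)); case: ifP => [c|c]; last first.
  by split=> [|[//|[_ _ /h2xy]]]; [left | rewrite c].
rewrite exec_store /store /=; split=> // _; right; split=> //; first exact/rch2.
exact/h2xy.
Qed.

Lemma check_spec rho s : params rho -> tables s.1 -> reached s.1 -> s.1 9 0 = 0 ->
  0 < (exec check_code rho s).1 9 0 <-> @undetectable S.
Proof.
move=> pr tab rch z9; have [p0 _ _ _ _] := pr.
have badE : @undetectable S <-> exists x y, bad x y.
  split=> [[x0 [y0 [q [r [ix iy qr c1 c2]]]]]|[x [y [xy [u [x0 [y0 [ix iy ->]]] c1] c2]]]].
    by exists q, r; split=> //; exists (x0, y0, true) => //; exists x0, y0.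
  by exists x0, y0, x, y.
pose P s' := tables s'.1 /\ reached s'.1.
pose I s' := P s' /\ (0 < s'.1 9 0 -> exists x y, bad x y).
have prU i j : params (upd (upd rho 7 i) 8 j) by apply: params_upd => //; apply: params_upd.
have step i j s' : i < n -> j < n -> P s' -> exists x y, [/\ i = enum_rank x, j = enum_rank y,
    P (exec (CSeq start_code (CSeq (closure_code 8) verdict_code)) (upd (upd rho 7 i) 8 j) s') &
    0 < (exec (CSeq start_code (CSeq (closure_code 8) verdict_code))
           (upd (upd rho 7 i) 8 j) s').1 9 0 <-> 0 < s'.1 9 0 \/ bad x y].
  move=> /stateP[x ->] /stateP[y ->] [tab' rch']; exists x, y.
  have [t1 r1 b1] := body_spec (x := x) (y := y) (prU _ _) tab' rch' erefl erefl.
  by split.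
apply: iff_trans (iff_sym badE); split.
  have [//] : I (exec check_code rho s).
  apply: for_inv => [|i s1]; first by split; rewrite ?z9.
  rewrite p0 => lti I1; apply: for_inv => // j s2; rewrite [upd _ _ _ 0]p0 => ltj [P2 b2].
  have [x [y [_ _ P3 b3]]] := step i j s2 lti ltj P2.
  by split=> // /b3[/b2 //|xy]; exists x, y.
case=> x [y xy].
pose Q s' := P s' /\ 0 < s'.1 9 0; suff [_] : Q (exec check_code rho s) by [].
have PP i j s' : i < n -> j < n -> P s' ->
    P (exec (CSeq start_code (CSeq (closure_code 8) verdict_code)) (upd (upd rho 7 i) 8 j) s').
  by move=> lti ltj P1; have [? [? []]] := step i j s' lti ltj P1.
have QQ i j s' : i < n -> j < n -> Q s' ->
    Q (exec (CSeq start_code (CSeq (closure_code 8) verdict_code)) (upd (upd rho 7 i) 8 j) s').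
  move=> lti ltj [P1 b1]; have [x' [y' [_ _ P2 b2]]] := step i j s' lti ltj P1.
  by split=> //; apply/b2; left.
apply: (for_reach (P := P) (j := enum_rank x)) => //; first by rewrite p0.
- move=> i s1; rewrite p0 => lti P1; apply: for_inv => // j s2; rewrite [upd _ _ _ 0]p0 => ltj.
  exact: PP.
- move=> i s1; rewrite p0 => lti P1; apply: for_inv => // j s2; rewrite [upd _ _ _ 0]p0 => ltj.
  exact: QQ.
move=> s1 P1; apply: (for_reach (P := P) (j := enum_rank y)) => //.
- by rewrite [upd _ _ _ 0]p0.
- move=> j s2; rewrite [upd _ _ _ 0]p0 => ltj; exact: PP.
- move=> j s2; rewrite [upd _ _ _ 0]p0 => ltj; exact: QQ.
move=> s2 P2; have [x' [y' [ex ey P3 b3]]] :=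
  step _ _ s2 (ltn_ord (enum_rank x)) (ltn_ord (enum_rank y)) P2.
split=> //; apply/b3; right.
by rewrite -(enum_rank_inj (val_inj ex)) -(enum_rank_inj (val_inj ey)).
Qed.

Lemma prog_spec rho : params rho -> rho 1 = #|event S| ->
  (exec prog rho (fun _ _ => 0, [seq (enum_rank x : nat) | x <- enum (initial S)]
    ++ [seq encode_label (label e) | e <- enum (event S)]
    ++ flatten [seq encode_transition tr | tr <- enum (transition S)])).1 9 0 = 0
  <-> @eventually_strongly_detectable S.
Proof.
move=> pr p1; set s0 := (_, _); rewrite /prog !exec_seq.
have [ini trs] := read_spec (fun _ _ => 0) pr p1; rewrite -/s0 in ini trs.
set s1 := exec read_code rho s0 in ini trs *.
have mov := rest_spec pr trs; set s2 := exec rest_code rho s1 in mov *.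
have off : forall i, i < n -> (exec offset_code rho s2).1 6 i = i * (n + n).
  by apply: offset_spec; rewrite // /s2 /s1 !exec_frame.
set s3 := exec offset_code rho s2 in off *.
have tab3 : tables s3.1.
  by split=> // t tr /mov[e1 e2 e3]; split; rewrite /s3 exec_frame.
have ini3 i : i < #|initial S| ->
    s3.1 0 i = nth 0 [seq (enum_rank x : nat) | x <- enum (initial S)] i.
  by move=> lti; rewrite /s3 exec_frame // /s2 exec_frame //; apply: ini.
have z7 i : s3.1 7 i = 0 by rewrite /s3 /s2 /s1 !exec_frame.
have h4 := init_spec pr tab3 ini3 z7; set s4 := exec init_code rho s3 in h4 *.
have tab4 : tables s4.1 by apply: tables_exec tab3.
have [tab5 h5] := @closure_spec 7 isT rho s4 pr tab4; set s5 := exec _ rho s4 in tab5 h5 *.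
have rch5 : reached s5.1.
  move=> v; apply: (iff_trans (h5 v)).
  by split=> -[u /h4 hu uv]; exists u.
have z9 : s5.1 9 0 = 0 by rewrite /s5 /s4 /s3 /s2 /s1 !exec_frame.
have chk := check_spec pr tab5 rch5 z9.
apply: iff_trans (iff_sym (undetectableP S)).
by split=> [z /chk|nu]; [rewrite z | apply/eqP; rewrite eqn0Ngt; apply/negP => /chk].
Qed.

End Correctness.

Theorem theorem6 :
  poly_time_decidable encode_automaton automaton_size
    eventually_strongly_detectable.
Proof.
apply: (poly_time_cmd (v := 9) (c := prog)) => // S.
exists #|state S|, #|event S|, #|output S|, #|initial S|, #|transition S|.
exists ([seq (enum_rank x : nat) | x <- enum (initial S)]
    ++ [seq encode_label (label e) | e <- enum (event S)]
    ++ flatten [seq encode_transition tr | tr <- enum (transition S)]).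
split=> //; last exact: prog_spec.
- have [les lee leo] : [/\ #|state S| <= automaton_size S, #|event S| <= automaton_size S
      & #|output S| <= automaton_size S] by rewrite /automaton_size; split; lia.
  have rank (T : finType) (x : T) : #|T| <= automaton_size S -> enum_rank x < automaton_size S.
    exact: leq_trans.
  rewrite /encode_automaton all_cat; apply/andP; split.
    by rewrite /automaton_size /=; do ?[apply/andP; split]; lia.
  rewrite !all_cat; apply/and3P; split.
  + by apply/allP => _ /mapP[x _ ->]; apply/ltnW/rank.
  (* A nonempty label is written as its rank plus one, still at most the number of outputs. *)
  + by apply/allP => _ /mapP[e _ ->]; case: (label e) => [o|] //=; apply: rank.
  + apply/allP => k /flattenP[_ /mapP[[[x e] y] _ ->]].
    by rewrite !inE /= => /or3P[] /eqP ->; apply/ltnW/rank.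
- by rewrite /automaton_size; lia.
Qed.
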